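(* Let $\gamma\in(0,1)$, let $r\in\mathbb{R}$, and let $\eta\in C^{2,\gamma}(\mathbb{R})$ be a positive function with $D_\eta=\{(x,y)\in\mathbb{R}^2: 0<y<\eta(x)\}$. Let $\psi\in C^{2,\gamma}(\overline{D_\eta})$ and suppose that $(\psi,\eta)$ solves the steady water wave problem with Bernoulli constant $r$: $$\Delta\psi=0 \ \text{ for } 0<y<\eta(x),$$ $$\tfrac12|\nabla\psi|^2+y=r \ \text{ on } y=\eta(x),$$ $$\psi=1 \ \text{ on } y=\eta(x),\qquad \psi=0 \ \text{ on } y=0.$$ Let $$\mathcal{S}=\int_0^{\eta(x)}\Big(\tfrac12\big(\psi_y^2(x,y)-\psi_x^2(x,y)\big)-y+r\Big)\,dy$$ be the flow force constant of the solution (a quantity independent of $x$). If $(\psi,\eta)$ is not a laminar flow, then $$\mathcal{S}>\tfrac12 r^2 .$$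
   Context: The problem is the non-dimensional stream function formulation for two-dimensional irrotational steady water waves over a flat bottom $y=0$ with free surface $y=\eta(x)$. No periodicity, symmetry or decay in $x$ is assumed. For every solution of the stated system, the integral defining $\mathcal{S}$ does not depend on $x$; its constant value is called the flow force constant. A laminar flow (uniform stream) is a solution with flat surface and $x$-independent stream function, i.e. $\eta(x)\equiv d$ and $\psi(x,y)=y/d$ for some constant $d>0$ (for which $r=\tfrac12 d^{-2}+d$). The spaces $C^{2,\gamma}(\mathbb{R})$ and $C^{2,\gamma}(\overline{D_\eta})$ are the usual Hölder spaces with finite norms: all derivatives up to order two are bounded, and the second-order derivatives are uniformly Hölder continuous with exponent $\gamma$. *)

(* Defs.v *)
From Stdlib Require Import Reals.
From Coquelicot Require Import Coquelicot.

Local Open Scope R_scope.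

(** ** Hölder spaces *)

Definition bounded_on {V : NormedModule R_AbsRing} (A : V -> Prop) (f : V -> R) : Prop :=
  exists M : R, forall p : V, A p -> Rabs (f p) <= M.

(* [p <> q] because [Rpower 0 gamma] is 1 rather than 0. On [R * R], the library's
   [norm] is the Euclidean one. *)
Definition holder_on {V : NormedModule R_AbsRing} (gamma : R) (A : V -> Prop) (f : V -> R)
    : Prop :=
  exists C : R, forall p q : V, A p -> A q -> p <> q ->
    Rabs (f p - f q) <= C * Rpower (norm (minus p q)) gamma.

Definition C2_holder_line (gamma : R) (f : R -> R) : Prop :=
  (forall k : nat, (k <= 2)%nat ->
     (forall x : R, ex_derive_n f k x) /\ bounded_on (fun _ : R => True) (Derive_n f k)) /\
  holder_on gamma (fun _ : R => True) (Derive_n f 2).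

Definition d_x (f : R * R -> R) (p : R * R) : R :=
  Derive (fun s : R => f (s, snd p)) (fst p).

Definition d_y (f : R * R -> R) (p : R * R) : R :=
  Derive (fun t : R => f (fst p, t)) (snd p).

Definition closure (D : R * R -> Prop) (p : R * R) : Prop :=
  forall P : R * R -> Prop, locally p P -> exists q : R * R, P q /\ D q.

(* The value at a point [p] of the closure of [D] of the continuous extension
   of [f] restricted to [D]; at points of [D] itself, [has_trace D f p l] says
   that [f] is continuous at [p] with [f p = l] (for [D] open). *)
Definition has_trace (D : R * R -> Prop) (f : R * R -> R) (p : R * R) (l : R) : Prop :=
  filterlim f (within D (locally p)) (locally l).

(* [f] is of class C^k in the open set [D], its partial derivatives of order
   at most [k] are bounded and extend continuously to the closure of [D], and
   those of order [k] are uniformly [gamma]-Hölder.  Only the values of [f] in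
   [D] matter. *)
Fixpoint Ck_holder_upto (k : nat) (gamma : R) (D : R * R -> Prop) (f : R * R -> R) : Prop :=
  bounded_on D f /\
  (forall p : R * R, closure D p -> exists l : R, has_trace D f p l) /\
  match k with
  | O => holder_on gamma D f
  | S k' =>
      (forall p : R * R, D p ->
         ex_derive (fun s : R => f (s, snd p)) (fst p) /\
         ex_derive (fun t : R => f (fst p, t)) (snd p)) /\
      Ck_holder_upto k' gamma D (d_x f) /\
      Ck_holder_upto k' gamma D (d_y f)
  end.

(* The second clause ties the values of [f] on the boundary to those inside. *)
Definition C2_holder_closure (gamma : R) (D : R * R -> Prop) (f : R * R -> R) : Prop :=
  Ck_holder_upto 2 gamma D f /\
  (forall p : R * R, closure D p ->
     filterlim f (within (closure D) (locally p)) (locally (f p))).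

(** ** Steady water waves *)

Definition fluid_domain (eta : R -> R) (p : R * R) : Prop :=
  0 < snd p < eta (fst p).

(* [psi] is a total function of which only the values on the closed fluid
   domain are meaningful, so its gradient on the free surface is the trace of
   the interior gradient. *)
Record steady_water_wave (r : R) (psi : R * R -> R) (eta : R -> R) : Prop := {
  laplace_eq : forall p : R * R, fluid_domain eta p ->
    d_x (d_x psi) p + d_y (d_y psi) p = 0;
  bernoulli_eq : forall x : R, exists u v : R,
    has_trace (fluid_domain eta) (d_x psi) (x, eta x) u /\
    has_trace (fluid_domain eta) (d_y psi) (x, eta x) v /\
    / 2 * (u ^ 2 + v ^ 2) + eta x = r;
  surface_eq : forall x : R, psi (x, eta x) = 1;
  bottom_eq : forall x : R, psi (x, 0) = 0
}.

(* The Riemann integral does not depend on the (junk) values that [d_x psi] and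
   [d_y psi] may take at the end points. *)
Definition flow_force_constant (r : R) (psi : R * R -> R) (eta : R -> R) (S : R) : Prop :=
  forall x : R,
    is_RInt (fun y : R => / 2 * (d_y psi (x, y) ^ 2 - d_x psi (x, y) ^ 2) - y + r)
      0 (eta x) S.

Definition laminar_flow (psi : R * R -> R) (eta : R -> R) : Prop :=
  exists d : R, 0 < d /\
    (forall x : R, eta x = d) /\
    (forall x y : R, 0 <= y <= d -> psi (x, y) = y / d).

(* Main.v *)
(** The harmonic function [G(x,y) = int_0^y (psi_y^2 - psi_x^2)/2] vanishes on the
    bottom and equals [c + (r - eta)^2/2] on the surface, where [c = S - r^2/2]; the
    claim is [c > 0].  Let [h = sup eta], [l = inf eta], and let [sg], [sg'] be the
    surface speeds that Bernoulli's law assigns to these depths.  By the maximum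
    principle [l psi <= y <= h psi] and [m psi <= G] with [m = c + (r - h)^2/2].
    Each inequality is an equality in the limit along surface points approaching
    the extremal depth, so comparing vertical derivatives there gives
    [1 <= l sg'], [h sg <= 1] and, once a Hopf barrier shows [sg > 0], [sg/2 <= m].
    The last one reads [c >= sg (4 - sg^3)/8], which settles [sg^3 < 4].  Otherwise
    the first two, with [h + sg^2/2 = l + sg'^2/2 = r] and the monotonicity of
    [1/s + s^2/2] for [s >= 1], force [h = l], and then [psi = y/h]: the flow is
    laminar.  As extrema over the unbounded line need not be attained, every step
    is quantitative, relying on the bounds for the second derivatives. *)

Require Import Defs.
From Stdlib Require Import Reals Lra Lia Classical ClassicalEpsilon.
From Coquelicot Require Import Coquelicot.

Local Open Scope R_scope.

(** The obstacle is that the values of the gradient on the boundary exist only as limits from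
    inside, so nothing can be differentiated along the surface or the bottom. Boundary conditions
    are therefore restated as linear rates in the distance to the boundary, with one constant [B]
    for the whole fluid, and facts about the surface are proved on the shifted graphs
    [y = eta x - t], uniformly in [x], before [t] tends to 0. The boundary values of [G] arise in
    this way: its tangential derivative, corrected on the surface by that of [(r - eta)^2 / 2],
    tends to 0 uniformly.

    The number [m] is the infimum of the surface values of [G], because [(r - eta)^2] decreases in
    [eta] up to [r] and [h <= r]. Near a crest the slope of the surface is small, hence so is the
    horizontal velocity, and the comparison of vertical derivatives reads [sg^2 / 2 <= m sg]. Only
    after division by [sg] does this bound [m] from below, which is why positivity of the crest
    speed has to be secured separately. Inserting [r - h = sg^2 / 2] into [m] then produces the
    threshold [sg^3 < 4]. *)

(** * A minimum principle on unbounded domains *)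

Lemma locally_interval (P : R -> Prop) (x : R) :
  locally x P <-> exists d : posreal, forall t, Rabs (t - x) < d -> P t.
Proof.
  split; intros [d Hd]; exists d; intros t Ht; apply Hd; exact Ht.
Qed.

Lemma is_derive_MVT (f df : R -> R) (a b : R) :
  a < b -> (forall t, a <= t <= b -> is_derive f t (df t)) ->
  exists c, a < c < b /\ f b - f a = df c * (b - a).
Proof.
  intros Hab Hd.
  destruct (MVT_cor2 f df a b Hab) as [c [Hc Hc']].
  - intros c Hc. apply is_derive_Reals, Hd, Hc.
  - exists c; split; assumption.
Qed.

(** If [l] were negative, [f1] would lie below [f1 x] just to the right of [x] and above it just to
    the left. At a minimum, the mean value theorem yields a point on the right with [f1 >= 0] and
    one on the left with [f1 <= 0]. Comparing the two sides makes it unnecessary to know that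
    [f1 x = 0]. *)
Lemma second_derive_at_min (f f1 : R -> R) (x l : R) :
  locally x (fun t => is_derive f t (f1 t)) -> is_derive f1 x l ->
  locally x (fun t => f x <= f t) -> 0 <= l.
Proof.
  intros H1 H2 H3.
  destruct (Rle_dec 0 l) as [|Hl]; [assumption|exfalso; apply Rnot_le_lt in Hl].
  destruct (proj1 (locally_interval _ _) H1) as [d1 H1'].
  destruct (proj1 (locally_interval _ _) H3) as [d3 H3'].
  apply is_derive_Reals in H2.
  assert (He : 0 < - l / 2) by lra.
  destruct (H2 _ He) as [d2 H2'].
  assert (Hslope : forall t, t <> x -> Rabs (t - x) < d2 ->
            Rabs (f1 t - f1 x - l * (t - x)) < - l / 2 * Rabs (t - x)).
  { intros t Ht Hd.
    assert (Hn : t - x <> 0) by lra.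
    specialize (H2' (t - x) Hn Hd).
    replace (x + (t - x)) with t in H2' by ring.
    replace (f1 t - f1 x - l * (t - x))
      with (((f1 t - f1 x) / (t - x) - l) * (t - x)) by (field; exact Hn).
    rewrite Rabs_mult. apply Rmult_lt_compat_r; [apply Rabs_pos_lt; exact Hn|exact H2']. }
  set (t0 := Rmin d1 (Rmin d2 d3) / 2).
  assert (Ht0 : 0 < t0 /\ t0 < d1 /\ t0 < d2 /\ t0 < d3).
  { unfold t0. pose proof (cond_pos d1); pose proof (cond_pos d2); pose proof (cond_pos d3).
    pose proof (Rmin_l d1 (Rmin d2 d3)); pose proof (Rmin_r d1 (Rmin d2 d3)).
    pose proof (Rmin_l d2 d3); pose proof (Rmin_r d2 d3).
    assert (0 < Rmin d1 (Rmin d2 d3)) by (repeat apply Rmin_glb_lt; assumption).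
    lra. }
  destruct Ht0 as [T0 [T1 [T2 T3]]].
  destruct (is_derive_MVT f f1 x (x + t0)) as [c [Hc Ec]]; [lra| |].
  { intros t Ht. apply H1'. rewrite Rabs_right; lra. }
  destruct (is_derive_MVT f f1 (x - t0) x) as [c' [Hc' Ec']]; [lra| |].
  { intros t Ht. apply H1'. rewrite Rabs_left1; lra. }
  assert (F1 : f x <= f (x + t0)) by (apply H3'; rewrite Rabs_right; lra).
  assert (F2 : f x <= f (x - t0)) by (apply H3'; rewrite Rabs_left1; lra).
  assert (G1 : 0 <= f1 c) by (apply Rnot_lt_le; intro; nra).
  assert (G2 : f1 c' <= 0) by (apply Rnot_lt_le; intro; nra).
  assert (S1 := Hslope c ltac:(lra) ltac:(rewrite Rabs_right; lra)).
  assert (S2 := Hslope c' ltac:(lra) ltac:(rewrite Rabs_left1; lra)).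
  rewrite (Rabs_right (c - x)) in S1 by lra.
  rewrite (Rabs_left1 (c' - x)) in S2 by lra.
  apply Rabs_def2 in S1; apply Rabs_def2 in S2.
  nra.
Qed.

(* [x^2 + 2 h^2 - 2 y^2] is strictly superharmonic, nonnegative on the strip and
   grows in [x], so a small multiple of it forces the infimum to be attained. *)
Lemma superharmonic_nonneg (D : R -> R -> Prop) (h M : R) (H Hx Hy Hxx Hyy : R -> R -> R) :
  (forall x y, D x y -> locally_2d D x y) ->
  (forall x y, D x y -> 0 <= y <= h) ->
  (forall x y, D x y -> is_derive (fun s => H s y) x (Hx x y)) ->
  (forall x y, D x y -> is_derive (fun s => Hx s y) x (Hxx x y)) ->
  (forall x y, D x y -> is_derive (fun t => H x t) y (Hy x y)) ->
  (forall x y, D x y -> is_derive (fun t => Hy x t) y (Hyy x y)) ->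
  (forall x y, D x y -> Hxx x y + Hyy x y <= 0) ->
  (forall x y, D x y -> continuity_2d_pt H x y) ->
  (forall x y, D x y -> - M <= H x y) ->
  (forall x y, ~ D x y -> forall eps : posreal,
     locally_2d (fun u v => D u v -> - eps <= H u v) x y) ->
  forall x y, D x y -> 0 <= H x y.
Proof.
  intros HD Hstrip dx dxx dy dyy Hlap Hcont Hbd Hbnd x0 y0 HD0.
  destruct (Rle_dec 0 (H x0 y0)) as [|Hneg]; [assumption|exfalso; apply Rnot_le_lt in Hneg].
  set (w := fun x y : R => x ^ 2 + 2 * h ^ 2 - 2 * y ^ 2).
  assert (Hw : forall x y, D x y -> x ^ 2 <= w x y).
  { intros x y Hxy. apply Hstrip in Hxy. unfold w. nra. }
  assert (Hw0 : 0 <= w x0 y0) by (pose proof (Hw _ _ HD0); nra).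
  (* Small enough that the perturbation costs less than half of [- H x0 y0], so [W] is still
     negative at this point. *)
  set (e := - H x0 y0 / (2 * (w x0 y0 + 1))).
  assert (He : 0 < e) by (unfold e; apply Rdiv_lt_0_compat; lra).
  set (W := fun x y => H x y + e * w x y).
  assert (HW0 : W x0 y0 < 0).
  { unfold W. assert (E : e * (2 * (w x0 y0 + 1)) = - H x0 y0) by (unfold e; field; lra). nra. }
  assert (HWH : forall x y, D x y -> H x y <= W x y).
  { intros x y Hxy. unfold W. pose proof (Hw _ _ Hxy). nra. }
  assert (HWc : forall x y, D x y -> continuity_2d_pt W x y).
  { intros x y Hxy. unfold W, w.
    apply continuity_2d_pt_plus; [apply Hcont; exact Hxy|].
    apply continuity_2d_pt_mult; [apply continuity_2d_pt_const|].
    apply continuity_2d_pt_minus; [apply continuity_2d_pt_plus|].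
    - unfold pow. repeat apply continuity_2d_pt_mult;
        first [apply continuity_2d_pt_id1 | apply continuity_2d_pt_const].
    - apply continuity_2d_pt_const.
    - unfold pow. repeat apply continuity_2d_pt_mult;
        first [apply continuity_2d_pt_id2 | apply continuity_2d_pt_const]. }
  destruct (completeness (fun t => exists u v, D u v /\ t = - W u v)) as [m [Hm1 Hm2]].
  { exists M. intros t [u [v [Huv ->]]]. pose proof (Hbd _ _ Huv). pose proof (HWH _ _ Huv). lra. }
  { exists (- W x0 y0), x0, y0. split; [exact HD0|reflexivity]. }
  assert (Hmu : forall u v, D u v -> - m <= W u v).
  { intros u v Huv. assert (- W u v <= m) by (apply Hm1; exists u, v; auto). lra. }
  assert (Hm0 : - m < 0) by (pose proof (Hmu _ _ HD0); lra).
  assert (Hatt : exists u v, D u v /\ W u v = - m).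
  { apply NNPP; intro Hno.
    assert (Hgt : forall u v, D u v -> - m < W u v).
    { intros u v Huv. destruct (Rle_lt_or_eq_dec _ _ (Hmu _ _ Huv)) as [|E]; [assumption|].
      exfalso; apply Hno; exists u, v; auto. }
    (* One number [d] serves both as the radius of a square and as the gap above the infimum [- m].
       Points outside [D] are included, so that a whole compact rectangle is covered. *)
    assert (Hg : forall u v, exists d : posreal, forall x y,
               Rabs (x - u) < d -> Rabs (y - v) < d -> D x y -> - m + d <= W x y).
    { intros u v. destruct (classic (D u v)) as [Huv|Huv].
      - assert (Hp : 0 < (W u v + m) / 2) by (pose proof (Hgt _ _ Huv); lra).
        destruct (HWc _ _ Huv (mkposreal _ Hp)) as [d Hd]. simpl in Hd.
        exists (mkposreal _ (Rmin_stable_in_posreal d (mkposreal _ Hp))); simpl.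
        intros x y Hx' Hy' Hxy.
        pose proof (Rmin_l d ((W u v + m) / 2)); pose proof (Rmin_r d ((W u v + m) / 2)).
        assert (A := Hd x y ltac:(lra) ltac:(lra)). apply Rabs_def2 in A. lra.
      - assert (Hp : 0 < m / 2) by lra.
        destruct (Hbnd _ _ Huv (mkposreal _ Hp)) as [d Hd]. simpl in Hd.
        exists (mkposreal _ (Rmin_stable_in_posreal d (mkposreal _ Hp))); simpl.
        intros x y Hx' Hy' Hxy.
        pose proof (Rmin_l d (m / 2)); pose proof (Rmin_r d (m / 2)).
        assert (A := Hd x y ltac:(lra) ltac:(lra) Hxy). pose proof (HWH _ _ Hxy). lra. }
    set (delta := fun u v => proj1_sig (constructive_indefinite_description _ (Hg u v))).
    assert (Hdelta : forall u v x y, Rabs (x - u) < delta u v -> Rabs (y - v) < delta u v ->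
              D x y -> - m + delta u v <= W x y).
    { intros u v. exact (proj2_sig (constructive_indefinite_description _ (Hg u v))). }
    (* For [Rabs x > L] the term [e * x ^ 2] exceeds [Rabs M], so [W] is nonnegative there and the
       rectangle of half-width [L] contains all that matters. *)
    set (L := 1 + Rabs M / e).
    destruct (compactness_value_2d (- L) L 0 h delta) as [d Hd].
    assert (Hall : forall x y, D x y -> - m + Rmin d m <= W x y).
    { intros x y Hxy. pose proof (Hstrip _ _ Hxy).
      pose proof (Rmin_l d m); pose proof (Rmin_r d m).
      destruct (Rle_dec (Rabs x) L) as [HL|HL].
      - apply Rabs_le_between in HL.
        apply NNPP; intro Hc. apply (Hd x y HL H0).
        intros [u [v [_ [_ [A [B C]]]]]]. apply Hc.
        pose proof (Hdelta u v x y A B Hxy). lra.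
      - assert (HL' : L < Rabs x) by lra.
        assert (HM : 0 <= Rabs M / e)
          by (apply Rmult_le_pos; [apply Rabs_pos|left; apply Rinv_0_lt_compat; lra]).
        assert (EM : e * (Rabs M / e) = Rabs M) by (field; lra).
        assert (Hx2 : Rabs M <= e * x ^ 2).
        { rewrite <- pow2_abs. unfold L in HL'. rewrite <- EM at 1.
          apply Rmult_le_compat_l; [lra|]. nra. }
        pose proof (Hw _ _ Hxy). pose proof (Hbd _ _ Hxy). pose proof (Rle_abs M).
        unfold W. nra. }
    assert (Hmin : 0 < Rmin d m) by (apply Rmin_glb_lt; [apply cond_pos|lra]).
    assert (A : m <= m - Rmin d m).
    { apply Hm2. intros t [u [v [Huv ->]]]. pose proof (Hall _ _ Huv). lra. }
    lra. }
  destruct Hatt as [u [v [Huv Emin]]].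
  assert (A1 : 0 <= Hxx u v + 2 * e).
  { apply (second_derive_at_min (fun s => W s v) (fun s => Hx s v + 2 * e * s) u).
    - apply locally_interval. destruct (HD _ _ Huv) as [d Hd]. exists d. intros t Ht.
      assert (Htv : D t v).
      { apply Hd; [exact Ht|]. replace (v - v) with 0 by ring. rewrite Rabs_R0. apply cond_pos. }
      unfold W, w. eapply is_derive_ext_loc; [apply filter_forall; intro; reflexivity|].
      evar_last.
      { apply (is_derive_plus (fun s => H s v)); [apply dx; exact Htv|].
        auto_derive; [exact I|reflexivity]. }
      unfold plus; simpl; ring.
    - evar_last.
      { apply (is_derive_plus (fun s => Hx s v)); [apply dxx; exact Huv|].
        auto_derive; [exact I|reflexivity]. }
      unfold plus; simpl; ring.
    - apply locally_interval. destruct (HD _ _ Huv) as [d Hd]. exists d. intros t Ht.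
      rewrite Emin. apply Hmu.
      apply Hd; [exact Ht|]. replace (v - v) with 0 by ring. rewrite Rabs_R0. apply cond_pos. }
  assert (A2 : 0 <= Hyy u v - 4 * e).
  { apply (second_derive_at_min (fun s => W u s) (fun s => Hy u s - 4 * e * s) v).
    - apply locally_interval. destruct (HD _ _ Huv) as [d Hd]. exists d. intros t Ht.
      assert (Htv : D u t).
      { apply Hd; [|exact Ht]. replace (u - u) with 0 by ring. rewrite Rabs_R0. apply cond_pos. }
      unfold W, w.
      evar_last.
      { apply (is_derive_plus (fun s => H u s)); [apply dy; exact Htv|].
        auto_derive; [exact I|reflexivity]. }
      unfold plus; simpl; ring.
    - evar_last.
      { apply (is_derive_minus (fun s => Hy u s)); [apply dyy; exact Huv|].
        auto_derive; [exact I|reflexivity]. }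
      unfold minus, plus, opp; simpl; ring.
    - apply locally_interval. destruct (HD _ _ Huv) as [d Hd]. exists d. intros t Ht.
      rewrite Emin. apply Hmu.
      apply Hd; [|exact Ht]. replace (u - u) with 0 by ring. rewrite Rabs_R0. apply cond_pos. }
  (* The perturbation has Laplacian [2 e - 4 e < 0], whereas the sum of the two second derivatives
     at the minimum is nonnegative. *)
  pose proof (Hlap _ _ Huv). lra.
Qed.

(** * One-variable estimates: limits at end points, interpolation, primitives *)

Lemma derive_bound_lipschitz (f df : R -> R) (a b B : R) :
  (forall t, a < t < b -> is_derive f t (df t)) ->
  (forall t, a < t < b -> Rabs (df t) <= B) ->
  forall s t, a < s < b -> a < t < b -> Rabs (f s - f t) <= B * Rabs (s - t).
Proof.
  intros Hd HB.
  assert (Hlt : forall s t, a < s < b -> a < t < b -> s < t ->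
            Rabs (f s - f t) <= B * Rabs (s - t)).
  { intros s t Hs Ht Hst.
    destruct (is_derive_MVT f df s t Hst) as [c [Hc E]].
    { intros u Hu. apply Hd; lra. }
    rewrite (Rabs_minus_sym (f s)), (Rabs_minus_sym s), E, Rabs_mult.
    apply Rmult_le_compat_r; [apply Rabs_pos|apply HB; lra]. }
  intros s t Hs Ht. destruct (Rtotal_order s t) as [H|[->|H]].
  - apply Hlt; assumption.
  - rewrite !Rminus_diag, Rabs_R0. lra.
  - rewrite (Rabs_minus_sym (f s)), (Rabs_minus_sym s). apply Hlt; assumption.
Qed.

Lemma le_of_forall_small (a b C T : R) :
  0 < T -> (forall t, 0 < t < T -> a <= b + C * t) -> a <= b.
Proof.
  intros HT H. apply Rnot_lt_le; intro Hab.
  set (t := Rmin (T / 2) ((a - b) / (2 * (Rabs C + 1)))).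
  assert (HC : 0 < 2 * (Rabs C + 1)) by (pose proof (Rabs_pos C); lra).
  assert (Ht : 0 < t) by (apply Rmin_glb_lt; [lra|apply Rdiv_lt_0_compat; lra]).
  pose proof (Rmin_l (T / 2) ((a - b) / (2 * (Rabs C + 1)))) as H1.
  pose proof (Rmin_r (T / 2) ((a - b) / (2 * (Rabs C + 1)))) as H2.
  fold t in H1, H2.
  assert (H3 : t * (2 * (Rabs C + 1)) <= a - b).
  { replace (a - b) with ((a - b) / (2 * (Rabs C + 1)) * (2 * (Rabs C + 1))) by (field; lra).
    apply Rmult_le_compat_r; lra. }
  assert (H4 := H t ltac:(lra)). pose proof (Rle_abs C). pose proof (Rabs_pos C). nra.
Qed.

(** The intervals [[f s - B s, f s + B s]] meet pairwise, so the supremum of their left end points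
    belongs to all of them. This gives the limit together with its rate. *)
Lemma lipschitz_limit_at_0 (f : R -> R) (T B : R) :
  0 < T ->
  (forall s t, 0 < s < T -> 0 < t < T -> Rabs (f s - f t) <= B * Rabs (s - t)) ->
  exists l, forall t, 0 < t < T -> Rabs (f t - l) <= B * t.
Proof.
  intros HT HL.
  assert (HB : 0 <= B).
  { assert (A := HL (T / 2) (T / 3) ltac:(lra) ltac:(lra)).
    pose proof (Rabs_pos (f (T / 2) - f (T / 3))).
    rewrite (Rabs_right (T / 2 - T / 3)) in A by lra. nra. }
  assert (Hnest : forall s t, 0 < s < T -> 0 < t < T -> f s - B * s <= f t + B * t).
  { intros s t Hs Ht. assert (A := HL s t Hs Ht). apply Rabs_le_between in A.
    assert (Rabs (s - t) <= s + t) by (apply Rabs_le; lra). nra. }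
  destruct (completeness (fun v => exists s, 0 < s < T /\ v = f s - B * s)) as [l [H1 H2]].
  { exists (f (T / 2) + B * (T / 2)). intros v [s [Hs ->]]. apply Hnest; lra. }
  { exists (f (T / 2) - B * (T / 2)), (T / 2). split; [lra|reflexivity]. }
  exists l. intros t Ht. apply Rabs_le.
  assert (f t - B * t <= l) by (apply H1; exists t; auto).
  assert (l <= f t + B * t) by (apply H2; intros v [s [Hs ->]]; apply Hnest; assumption).
  lra.
Qed.

(** A quantitative comparison of derivatives at an end point. On the last stretch of length [t] the
    derivative is at least [w - L t], so [f (b - t)] is at most [d - (w - L t) t], and it is not
    negative. The defect [d] measures how far [f] is from touching 0 at [b]; the error [K s] at
    [b - s] vanishes with [s]. *)
Lemma derive_at_touching_end (f df : R -> R) (a b w d K L : R) :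
  (forall y, a < y < b -> is_derive f y (df y)) ->
  (forall y, a < y < b -> 0 <= f y) ->
  (forall y, a < y < b -> Rabs (f y - d) <= K * (b - y)) ->
  (forall y, a < y < b -> Rabs (df y - w) <= L * (b - y)) ->
  forall t, 0 < t < b - a -> w * t <= d + L * t ^ 2.
Proof.
  intros Hd Hf HK HL t Ht.
  assert (HL0 : 0 <= L).
  { assert (A := HL (b - t) ltac:(lra)). pose proof (Rabs_pos (df (b - t) - w)). nra. }
  apply (le_of_forall_small _ _ (K + Rabs (w - L * t)) t); [lra|].
  intros s Hs.
  destruct (is_derive_MVT f df (b - t) (b - s)) as [c [Hc E]]; [lra| |].
  { intros u Hu. apply Hd. lra. }
  assert (A1 := HL c ltac:(lra)). apply Rabs_le_between in A1.
  assert (A2 := HK (b - s) ltac:(lra)). apply Rabs_le_between in A2.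
  assert (A3 := Hf (b - t) ltac:(lra)).
  pose proof (Rle_abs (w - L * t)).
  assert (A4 : w - L * t <= df c) by nra.
  assert (A5 : (w - L * t) * (t - s) <= df c * (t - s)) by (apply Rmult_le_compat_r; lra).
  replace (b - s - (b - t)) with (t - s) in E by ring.
  replace (b - (b - s)) with s in A2 by ring.
  nra.
Qed.

(** Interpolation: the difference quotient over length [t] is at most [2 e / t], and the derivative
    varies by at most [L t] on that length. It turns a boundary condition on a function into one on
    its tangential derivative. *)
Lemma small_derive_of_small (f df : R -> R) (x t e L : R) :
  0 < t ->
  (forall s, x <= s <= x + t -> is_derive f s (df s)) ->
  (forall s, x <= s <= x + t -> Rabs (df s - df x) <= L * (s - x)) ->
  (forall s, x <= s <= x + t -> Rabs (f s) <= e) ->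
  Rabs (df x) <= 2 * e / t + L * t.
Proof.
  intros Ht Hd HL He.
  destruct (is_derive_MVT f df x (x + t)) as [c [Hc E]]; [lra|exact Hd|].
  assert (HL0 : 0 <= L).
  { assert (A := HL (x + t) ltac:(lra)). pose proof (Rabs_pos (df (x + t) - df x)). nra. }
  assert (A1 := HL c ltac:(lra)).
  assert (A2 := He x ltac:(lra)). assert (A3 := He (x + t) ltac:(lra)).
  assert (A4 : Rabs (df c) <= 2 * e / t).
  { replace (df c) with ((f (x + t) - f x) / t) by (rewrite E; field; lra).
    unfold Rdiv. rewrite Rabs_mult, (Rabs_right (/ t)) by (left; apply Rinv_0_lt_compat; lra).
    apply Rmult_le_compat_r; [left; apply Rinv_0_lt_compat; lra|].
    apply Rabs_le. apply Rabs_le_between in A2, A3. lra. }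
  replace (df x) with (df c - (df c - df x)) by ring.
  eapply Rle_trans; [apply Rabs_triang|]. rewrite Rabs_Ropp. nra.
Qed.

(** A substitute for differentiating boundary values. The limits at [t = 0] exist for each [x];
    since [fx] is small uniformly in [x], the values of [f] at two abscissas differ arbitrarily
    little once [t] is small, so the limits agree. *)
Lemma uniform_limit_constant (f fx : R -> R -> R) (T B : R) :
  0 < T ->
  (forall x s t, 0 < s < T -> 0 < t < T -> Rabs (f x s - f x t) <= B * Rabs (s - t)) ->
  (forall x t, 0 < t < T -> is_derive (fun s => f s t) x (fx x t)) ->
  (forall e, 0 < e -> exists d, 0 < d /\
     forall x t, 0 < t < d -> t < T -> Rabs (fx x t) <= e) ->
  exists c, forall x t, 0 < t < T -> Rabs (f x t - c) <= B * t.
Proof.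
  intros HT HL Hd Hs.
  destruct (lipschitz_limit_at_0 (f 0) T B HT (HL 0)) as [c Hc].
  exists c. intros x t Ht.
  destruct (lipschitz_limit_at_0 (f x) T B HT (HL x)) as [l Hl].
  enough (E : l = c) by (rewrite <- E; apply Hl, Ht).
  apply cond_eq. intros e He.
  assert (He' : 0 < e / 4 / (Rabs x + 1))
    by (apply Rdiv_lt_0_compat; pose proof (Rabs_pos x); lra).
  destruct (Hs _ He') as [d [Hd0 Hd1]].
  set (s := Rmin (Rmin (d / 2) (T / 2)) (e / 8 / (Rabs B + 1))).
  assert (Hs0 : 0 < s /\ s <= d / 2 /\ s <= T / 2 /\ s <= e / 8 / (Rabs B + 1)).
  { unfold s. split.
    - repeat apply Rmin_glb_lt; try lra. apply Rdiv_lt_0_compat; pose proof (Rabs_pos B); lra.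
    - pose proof (Rmin_l (Rmin (d / 2) (T / 2)) (e / 8 / (Rabs B + 1))).
      pose proof (Rmin_r (Rmin (d / 2) (T / 2)) (e / 8 / (Rabs B + 1))).
      pose proof (Rmin_l (d / 2) (T / 2)). pose proof (Rmin_r (d / 2) (T / 2)). lra. }
  destruct Hs0 as [S0 [S1 [S2 S3]]].
  assert (A1 := Hl s ltac:(lra)). assert (A2 := Hc s ltac:(lra)).
  assert (A3 : Rabs (f x s - f 0 s) <= e / 4 / (Rabs x + 1) * Rabs (x - 0)).
  { apply (derive_bound_lipschitz (fun u => f u s) (fun u => fx u s)
             (- Rabs x - 1) (Rabs x + 1)).
    - intros u _. apply Hd. lra.
    - intros u _. apply Hd1; lra.
    - pose proof (Rabs_le_between x (Rabs x)) as [Q _]. specialize (Q (Rle_refl _)). lra.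
    - pose proof (Rabs_pos x). lra. }
  rewrite Rminus_0_r in A3.
  assert (A4 : e / 4 / (Rabs x + 1) * Rabs x <= e / 4).
  { pose proof (Rabs_pos x).
    replace (e / 4) with (e / 4 / (Rabs x + 1) * (Rabs x + 1)) at 2 by (field; lra).
    apply Rmult_le_compat_l; lra. }
  assert (A5 : B * s <= e / 8).
  { pose proof (Rabs_pos B). pose proof (Rle_abs B).
    replace (e / 8) with ((Rabs B + 1) * (e / 8 / (Rabs B + 1))) by (field; lra).
    assert (0 <= e / 8 / (Rabs B + 1)) by lra.
    nra. }
  apply Rabs_le_between in A1, A2, A3. apply Rabs_def1; lra.
Qed.

(** The values of [f] and [F] at [a] and [b] are arbitrary. The Lipschitz bound lets [f] be extended
    continuously to some [g]; then [F] minus the integral of [g] is constant inside, and letting [y]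
    tend to the end points expresses [la] and [lb] through that integral. *)
Lemma is_RInt_primitive_open (F f : R -> R) (a b la lb K B : R) :
  a < b ->
  (forall y, a < y < b -> is_derive F y (f y)) ->
  (forall s t, a < s < b -> a < t < b -> Rabs (f s - f t) <= B * Rabs (s - t)) ->
  (forall y, a < y < b -> Rabs (F y - la) <= K * (y - a)) ->
  (forall y, a < y < b -> Rabs (F y - lb) <= K * (b - y)) ->
  is_RInt f a b (lb - la).
Proof.
  intros Hab HF Hf Hla Hlb.
  assert (HB : 0 <= B).
  { assert (A := Hf ((a + b) / 2) ((2 * a + b) / 3) ltac:(lra) ltac:(lra)).
    pose proof (Rabs_pos (f ((a + b) / 2) - f ((2 * a + b) / 3))).
    rewrite (Rabs_right ((a + b) / 2 - (2 * a + b) / 3)) in A by lra. nra. }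
  destruct (lipschitz_limit_at_0 (fun t => f (a + t)) (b - a) B) as [fa Hfa]; [lra| |].
  { intros s t Hs Ht. replace (s - t) with (a + s - (a + t)) by ring. apply Hf; lra. }
  destruct (lipschitz_limit_at_0 (fun t => f (b - t)) (b - a) B) as [fb Hfb]; [lra| |].
  { intros s t Hs Ht. rewrite (Rabs_minus_sym s).
    replace (t - s) with (b - s - (b - t)) by ring. apply Hf; lra. }
  destruct (C0_extension_lt (T := R_UniformSpace) f fa fb a b Hab) as [g [Hg [Hgf [Hga Hgb]]]].
  { intros c Hc. apply filterlim_locally. intros e.
    assert (HB1 : 0 < B + 1) by lra.
    assert (Hd : 0 < Rmin (e / (B + 1)) (Rmin (c - a) (b - c))).
    { repeat apply Rmin_glb_lt; try lra. apply Rdiv_lt_0_compat; [apply cond_pos|lra]. }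
    exists (mkposreal _ Hd). intros y Hy.
    change (Rabs (y - c) < Rmin (e / (B + 1)) (Rmin (c - a) (b - c))) in Hy.
    change (Rabs (f y - f c) < e).
    pose proof (Rmin_l (e / (B + 1)) (Rmin (c - a) (b - c))).
    pose proof (Rmin_r (e / (B + 1)) (Rmin (c - a) (b - c))).
    pose proof (Rmin_l (c - a) (b - c)). pose proof (Rmin_r (c - a) (b - c)).
    assert (Hy' : - (Rmin (c - a) (b - c)) < y - c < Rmin (c - a) (b - c))
      by (apply Rabs_def2 in Hy; lra).
    eapply Rle_lt_trans; [apply Hf; lra|].
    replace (pos e) with ((B + 1) * (e / (B + 1))) by (field; lra).
    pose proof (Rabs_pos (y - c)). nra. }
  { apply filterlim_locally. intros e.
    assert (HB1 : 0 < B + 1) by lra.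
    assert (Hd : 0 < Rmin (e / (B + 1)) (b - a)).
    { repeat apply Rmin_glb_lt; try lra. apply Rdiv_lt_0_compat; [apply cond_pos|lra]. }
    exists (mkposreal _ Hd). intros y Hy Hya.
    change (Rabs (y - a) < Rmin (e / (B + 1)) (b - a)) in Hy.
    change (Rabs (f y - fa) < e). rewrite Rabs_right in Hy by lra.
    pose proof (Rmin_l (e / (B + 1)) (b - a)). pose proof (Rmin_r (e / (B + 1)) (b - a)).
    assert (A := Hfa (y - a) ltac:(lra)).
    assert (Ea : forall u : R, a + (u - a) = u) by (intro; ring). rewrite Ea in A.
    eapply Rle_lt_trans; [exact A|].
    replace (pos e) with ((B + 1) * (e / (B + 1))) by (field; lra). nra. }
  { apply filterlim_locally. intros e.
    assert (HB1 : 0 < B + 1) by lra.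
    assert (Hd : 0 < Rmin (e / (B + 1)) (b - a)).
    { repeat apply Rmin_glb_lt; try lra. apply Rdiv_lt_0_compat; [apply cond_pos|lra]. }
    exists (mkposreal _ Hd). intros y Hy Hyb.
    change (Rabs (y - b) < Rmin (e / (B + 1)) (b - a)) in Hy.
    change (Rabs (f y - fb) < e). rewrite Rabs_left1 in Hy by lra.
    pose proof (Rmin_l (e / (B + 1)) (b - a)). pose proof (Rmin_r (e / (B + 1)) (b - a)).
    assert (A := Hfb (b - y) ltac:(lra)).
    assert (Eb : forall u : R, b - (b - u) = u) by (intro; ring). rewrite Eb in A.
    eapply Rle_lt_trans; [exact A|].
    replace (pos e) with ((B + 1) * (e / (B + 1))) by (field; lra). nra. }
  assert (Hex : forall u v, ex_RInt g u v)
    by (intros u v; apply (ex_RInt_continuous (V := R_CompleteNormedModule));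
        intros z _; exact (Hg z)).
  assert (HI : forall y, is_derive (fun y => RInt g a y) y (g y)).
  { intros y. apply (is_derive_RInt g (fun y => RInt g a y) a y).
    - apply filter_forall. intro z. apply (RInt_correct (V := R_CompleteNormedModule)), Hex.
    - exact (Hg y). }
  set (J := fun y => F y - RInt g a y).
  assert (HJ : forall s t, a < s < b -> a < t < b -> Rabs (J s - J t) <= 0 * Rabs (s - t)).
  { apply (derive_bound_lipschitz J (fun _ => 0)).
    - intros t Ht. evar_last.
      { apply (is_derive_minus F); [apply HF, Ht|apply HI]. }
      unfold minus, plus, opp; simpl. rewrite Hgf by lra. ring.
    - intros t Ht. rewrite Rabs_R0. lra. }
  set (m := (a + b) / 2).
  assert (HJm : forall y, a < y < b -> F y = J m + RInt g a y).
  { intros y Hy. assert (A := HJ y m Hy ltac:(unfold m; lra)).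
    rewrite Rmult_0_l in A. pose proof (Rabs_pos (J y - J m)).
    assert (Q : J y - J m = 0) by (apply Rabs_eq_0; lra). unfold J in Q |- *. lra. }
  assert (Hlim : forall z l (s : R -> R),
            (forall t, 0 < t < b - a -> a < s t < b) ->
            (forall t, 0 < t < b - a -> Rabs (s t - z) <= t) ->
            (forall t, 0 < t < b - a -> Rabs (F (s t) - l) <= K * t) ->
            l = J m + RInt g a z).
  { intros z l s Hs1 Hs2 Hs3. apply cond_eq. intros e He.
    assert (He2 : 0 < e / 2) by lra.
    assert (Hc : continuous (fun y => RInt g a y) z)
      by (apply (ex_derive_continuous (fun y => RInt g a y)); eexists; apply HI).
    destruct (proj1 (filterlim_locally _ _) Hc (mkposreal _ He2)) as [d Hd].
    set (t := Rmin (Rmin (d / 2) ((b - a) / 2)) (e / 4 / (Rabs K + 1))).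
    assert (HK : 0 < Rabs K + 1) by (pose proof (Rabs_pos K); lra).
    assert (Ht : 0 < t /\ t <= d / 2 /\ t <= (b - a) / 2 /\ t <= e / 4 / (Rabs K + 1)).
    { unfold t. pose proof (cond_pos d). split.
      - repeat apply Rmin_glb_lt; try lra. apply Rdiv_lt_0_compat; lra.
      - pose proof (Rmin_l (Rmin (d / 2) ((b - a) / 2)) (e / 4 / (Rabs K + 1))).
        pose proof (Rmin_r (Rmin (d / 2) ((b - a) / 2)) (e / 4 / (Rabs K + 1))).
        pose proof (Rmin_l (d / 2) ((b - a) / 2)). pose proof (Rmin_r (d / 2) ((b - a) / 2)). lra. }
    destruct Ht as [T0 [T1 [T2 T3]]]. pose proof (cond_pos d).
    assert (Q1 := Hs1 t ltac:(lra)). assert (Q2 := Hs2 t ltac:(lra)).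
    assert (Q3 := Hs3 t ltac:(lra)).
    assert (Q4 : Rabs (RInt g a (s t) - RInt g a z) < e / 2).
    { apply (Hd (s t)). change (Rabs (s t - z) < d). lra. }
    assert (Q5 : K * t <= e / 4).
    { pose proof (Rabs_pos K). pose proof (Rle_abs K).
      replace (e / 4) with ((Rabs K + 1) * (e / 4 / (Rabs K + 1))) by (field; lra). nra. }
    rewrite (HJm _ Q1) in Q3. apply Rabs_le_between in Q3. apply Rabs_def2 in Q4.
    apply Rabs_def1; lra. }
  assert (Ela : la = J m + RInt g a a).
  { apply (Hlim a la (fun t => a + t)).
    - intros; lra.
    - intros t Ht. replace (a + t - a) with t by ring. rewrite Rabs_right; lra.
    - intros t Ht. replace t with (a + t - a) at 2 by ring. apply Hla; lra. }
  assert (Elb : lb = J m + RInt g a b).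
  { apply (Hlim b lb (fun t => b - t)).
    - intros; lra.
    - intros t Ht. replace (b - t - b) with (- t) by ring. rewrite Rabs_left; lra.
    - intros t Ht. replace t with (b - (b - t)) at 2 by ring. apply Hlb; lra. }
  rewrite RInt_point in Ela. unfold zero in Ela; simpl in Ela.
  replace (lb - la) with (RInt g a b) by lra.
  apply (is_RInt_ext g).
  - intros y Hy. rewrite Rmin_left, Rmax_right in Hy by lra. apply Hgf, Hy.
  - apply (RInt_correct (V := R_CompleteNormedModule)), Hex.
Qed.

(** * Primitives and differentiation along the free surface *)

(** The curried counterpart of [fluid_domain], in the form used by [locally_2d] and
    [continuity_2d_pt]. *)
Definition below (eta : R -> R) (x y : R) : Prop := 0 < y < eta x.

Lemma below_open (eta : R -> R) (x y : R) :
  continuous eta x -> below eta x y -> locally_2d (below eta) x y.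
Proof.
  intros Hc [Hy1 Hy2].
  assert (He : 0 < Rmin y ((eta x - y) / 2)) by (apply Rmin_glb_lt; lra).
  destruct (proj1 (filterlim_locally _ _) Hc (mkposreal _ He)) as [d Hd].
  exists (mkposreal _ (Rmin_stable_in_posreal d (mkposreal _ He))). intros u v Hu Hv.
  simpl in Hu, Hv.
  pose proof (Rmin_l d (Rmin y ((eta x - y) / 2))).
  pose proof (Rmin_r d (Rmin y ((eta x - y) / 2))).
  pose proof (Rmin_l y ((eta x - y) / 2)). pose proof (Rmin_r y ((eta x - y) / 2)).
  assert (A : Rabs (eta u - eta x) < Rmin y ((eta x - y) / 2)).
  { apply (Hd u). change (Rabs (u - x) < d). lra. }
  apply Rabs_def2 in A. assert (Hv' := Rabs_def2 _ _ Hv). split; lra.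
Qed.

Lemma continuity_2d_pt_slice_x (f : R -> R -> R) (x y : R) :
  continuity_2d_pt f x y -> continuous (fun s => f s y) x.
Proof.
  intros Hf. apply filterlim_locally. intros e. destruct (Hf e) as [d Hd].
  exists d. intros s Hs. apply Hd; [exact Hs|]. rewrite Rminus_diag, Rabs_R0. apply cond_pos.
Qed.

Lemma continuity_2d_pt_slice_y (f : R -> R -> R) (x y : R) :
  continuity_2d_pt f x y -> continuous (fun t => f x t) y.
Proof.
  intros Hf. apply filterlim_locally. intros e. destruct (Hf e) as [d Hd].
  exists d. intros s Hs. apply Hd; [|exact Hs]. rewrite Rminus_diag, Rabs_R0. apply cond_pos.
Qed.

Lemma locally_2d_slice_x (P : R -> R -> Prop) (x y : R) :
  locally_2d P x y -> locally x (fun s => P s y).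
Proof.
  intros [d Hd]. exists d. intros s Hs. apply Hd; [exact Hs|].
  rewrite Rminus_diag, Rabs_R0. apply cond_pos.
Qed.

Lemma differentiable_of_C1 (D : R -> R -> Prop) (f fx fy : R -> R -> R) (x y : R) :
  locally_2d D x y ->
  (forall u v, D u v -> is_derive (fun s => f s v) u (fx u v)) ->
  (forall u v, D u v -> is_derive (fun t => f u t) v (fy u v)) ->
  continuity_2d_pt fx x y ->
  differentiable_pt_lim f x y (fx x y) (fy x y).
Proof.
  intros HD Hx Hy Hc. apply filterdiff_differentiable_pt_lim.
  apply (is_derive_filterdiff f x y fx (fy x y)).
  - apply locally_2d_locally in HD. revert HD. apply filter_imp. intros [u v] Huv.
    apply Hx, Huv.
  - apply Hy. exact (locally_2d_singleton _ _ _ HD).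
  - apply continuity_2d_pt_filterlim, Hc.
Qed.

Lemma continuity_of_C1 (D : R -> R -> Prop) (f fx fy : R -> R -> R) (x y : R) :
  locally_2d D x y ->
  (forall u v, D u v -> is_derive (fun s => f s v) u (fx u v)) ->
  (forall u v, D u v -> is_derive (fun t => f u t) v (fy u v)) ->
  continuity_2d_pt fx x y ->
  continuity_2d_pt f x y.
Proof.
  intros HD Hx Hy Hc. apply differentiable_continuity_pt.
  exists (fx x y), (fy x y). apply (differentiable_of_C1 D); assumption.
Qed.

Lemma is_derive_along_graph (D : R -> R -> Prop) (f fx fy : R -> R -> R) (g : R -> R)
    (x dg : R) :
  locally_2d D x (g x) ->
  (forall u v, D u v -> is_derive (fun s => f s v) u (fx u v)) ->
  (forall u v, D u v -> is_derive (fun t => f u t) v (fy u v)) ->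
  continuity_2d_pt fx x (g x) ->
  is_derive g x dg ->
  is_derive (fun s => f s (g s)) x (fx x (g x) + fy x (g x) * dg).
Proof.
  intros HD Hx Hy Hc Hg. apply is_derive_Reals.
  replace (fx x (g x) + fy x (g x) * dg) with (fx x (g x) * 1 + fy x (g x) * dg) by ring.
  apply (derivable_pt_lim_comp_2d f (fun s => s) g).
  - apply (differentiable_of_C1 D); assumption.
  - apply derivable_pt_lim_id.
  - apply is_derive_Reals, Hg.
Qed.

Lemma between_below (eta : R -> R) (x y0 y t : R) :
  below eta x y0 -> below eta x y -> Rmin y0 y <= t <= Rmax y0 y -> below eta x t.
Proof.
  intros [A1 A2] [B1 B2] [C1 C2]. split.
  - eapply Rlt_le_trans; [|exact C1]. apply Rmin_glb_lt; assumption.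
  - eapply Rle_lt_trans; [exact C2|]. apply Rmax_lub_lt; assumption.
Qed.

(** The form [P dx + Q dy] is integrated along the line at height [y0], which lies in the fluid for
    all [x], and then vertically. Such paths stay below the graph, whatever its shape. *)
Lemma closed_form_primitive (eta : R -> R) (y0 : R) (P Q S : R -> R -> R) :
  (forall x, continuous eta x) ->
  (forall x, below eta x y0) ->
  (forall x y, below eta x y -> is_derive (fun t => P x t) y (S x y)) ->
  (forall x y, below eta x y -> is_derive (fun s => Q s y) x (S x y)) ->
  (forall x y, below eta x y -> continuity_2d_pt P x y) ->
  (forall x y, below eta x y -> continuity_2d_pt Q x y) ->
  (forall x y, below eta x y -> continuity_2d_pt S x y) ->
  exists G : R -> R -> R, forall x y, below eta x y ->
    is_derive (fun s => G s y) x (P x y) /\ is_derive (fun t => G x t) y (Q x y).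
Proof.
  intros Hc Hy0 HP HQ cP cQ cS.
  set (G := fun x y => RInt (fun s => P s y0) 0 x + RInt (fun t => Q x t) y0 y).
  assert (exQ : forall x y, below eta x y -> ex_RInt (fun t => Q x t) y0 y).
  { intros x y Hxy. apply (ex_RInt_continuous (V := R_CompleteNormedModule)).
    intros t Ht. apply continuity_2d_pt_slice_y, cQ.
    apply (between_below eta x y0 y); auto. }
  exists G. intros x y Hxy. split.
  - replace (P x y) with (P x y0 + (P x y - P x y0)) by ring.
    apply (is_derive_plus (fun x => RInt (fun s => P s y0) 0 x)).
    + apply (is_derive_RInt (fun s => P s y0) _ 0 x).
      * apply filter_forall. intros z. apply (RInt_correct (V := R_CompleteNormedModule)).
        apply (ex_RInt_continuous (V := R_CompleteNormedModule)).
        intros s _. apply (continuity_2d_pt_slice_x P), cP, Hy0.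
      * apply (continuity_2d_pt_slice_x P), cP, Hy0.
    + assert (Hloc : locally x (fun s => below eta s y))
        by (apply (locally_2d_slice_x (below eta)), below_open; auto).
      (* Closedness: the derivative in [x] of the vertical part is the integral of [S = P_y], which
         replaces the value of [P] at height [y0] by its value at height [y]. *)
      assert (E : RInt (fun t => Derive (fun u => Q u t) x) y0 y = P x y - P x y0).
      { rewrite (RInt_ext _ (fun t => S x t)).
        - apply is_RInt_unique. apply (is_RInt_derive (fun t => P x t)).
          + intros t Ht. apply HP, (between_below eta x y0 y); auto.
          + intros t Ht. apply (continuity_2d_pt_slice_y S), cS, (between_below eta x y0 y); auto.
        - intros t Ht. apply is_derive_unique, HQ, (between_below eta x y0 y); auto. lra. }
      rewrite <- E. apply (is_derive_RInt_param Q y0 y x).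
      * revert Hloc. apply filter_imp. intros s Hs t Ht.
        exists (S s t). apply HQ, (between_below eta s y0 y); auto.
      * intros t Ht. assert (Hxt : below eta x t) by (apply (between_below eta x y0 y); auto).
        apply (continuity_2d_pt_ext_loc S).
        -- destruct (below_open eta x t (Hc x) Hxt) as [d Hd]. exists d. intros u v Hu Hv.
           symmetry. apply is_derive_unique, HQ, Hd; assumption.
        -- apply cS, Hxt.
      * revert Hloc. apply filter_imp. intros s Hs. apply exQ, Hs.
  - replace (Q x y) with (0 + Q x y) by ring.
    apply (is_derive_plus (fun _ => RInt (fun s => P s y0) 0 x)).
    + apply @is_derive_const.
    + apply (is_derive_RInt (fun t => Q x t) _ y0 y).
      * assert (Hloc : locally y (fun t => below eta x t)).
        { destruct (below_open eta x y (Hc x) Hxy) as [d Hd]. exists d. intros t Ht.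
          apply Hd; [|exact Ht]. rewrite Rminus_diag, Rabs_R0. apply cond_pos. }
        revert Hloc. apply filter_imp. intros t Ht.
        apply (RInt_correct (V := R_CompleteNormedModule)), exQ, Ht.
      * apply continuity_2d_pt_slice_y, cQ, Hxy.
Qed.

(** * Boundary behaviour of the flow *)

Set Implicit Arguments.
Unset Strict Implicit.

Lemma Rabs_mult_le (a b A B : R) : Rabs a <= A -> Rabs b <= B -> Rabs (a * b) <= A * B.
Proof.
  intros HA HB. rewrite Rabs_mult. apply Rmult_le_compat; auto using Rabs_pos.
Qed.

Lemma Rabs_plus_le (a b A B : R) : Rabs a <= A -> Rabs b <= B -> Rabs (a + b) <= A + B.
Proof.
  intros HA HB. eapply Rle_trans; [apply Rabs_triang|lra].
Qed.

(* The water wave problem with all boundary conditions turned into estimates at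
   interior points. *)
Record bounded_wave (B r : R) (eta eta1 eta2 : R -> R) (p px py pxx pxy pyy : R -> R -> R)
    : Prop := {
  bw_one : 1 <= B;
  bw_eta_pos : forall x, 0 < eta x;
  bw_eta_le : forall x, eta x <= B;
  bw_eta1_le : forall x, Rabs (eta1 x) <= B;
  bw_eta2_le : forall x, Rabs (eta2 x) <= B;
  bw_eta1 : forall x, is_derive eta x (eta1 x);
  bw_eta2 : forall x, is_derive eta1 x (eta2 x);
  bw_px : forall x y, below eta x y -> is_derive (fun s => p s y) x (px x y);
  bw_py : forall x y, below eta x y -> is_derive (fun t => p x t) y (py x y);
  bw_pxx : forall x y, below eta x y -> is_derive (fun s => px s y) x (pxx x y);
  bw_pxy : forall x y, below eta x y -> is_derive (fun t => px x t) y (pxy x y);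
  bw_pyx : forall x y, below eta x y -> is_derive (fun s => py s y) x (pxy x y);
  bw_pyy : forall x y, below eta x y -> is_derive (fun t => py x t) y (pyy x y);
  bw_pxx_cont : forall x y, below eta x y -> continuity_2d_pt pxx x y;
  bw_pxy_cont : forall x y, below eta x y -> continuity_2d_pt pxy x y;
  bw_px_le : forall x y, below eta x y -> Rabs (px x y) <= B;
  bw_py_le : forall x y, below eta x y -> Rabs (py x y) <= B;
  bw_pxx_le : forall x y, below eta x y -> Rabs (pxx x y) <= B;
  bw_pxy_le : forall x y, below eta x y -> Rabs (pxy x y) <= B;
  bw_pyy_le : forall x y, below eta x y -> Rabs (pyy x y) <= B;
  bw_laplace : forall x y, below eta x y -> pxx x y + pyy x y = 0;
  bw_bottom : forall x y, below eta x y -> Rabs (p x y) <= B * y;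
  bw_surface : forall x y, below eta x y -> Rabs (p x y - 1) <= B * (eta x - y);
  bw_bernoulli : forall x, exists u v,
    (forall y, below eta x y -> Rabs (px x y - u) <= B * (eta x - y)) /\
    (forall y, below eta x y -> Rabs (py x y - v) <= B * (eta x - y)) /\
    / 2 * (u ^ 2 + v ^ 2) + eta x = r
}.

Lemma bw_eta_cont (B r : R) eta eta1 eta2 p px py pxx pxy pyy :
  bounded_wave B r eta eta1 eta2 p px py pxx pxy pyy -> forall x, continuous eta x.
Proof.
  intros W x. apply (ex_derive_continuous eta). exists (eta1 x). apply (bw_eta1 W).
Qed.

Lemma bw_px_cont (B r : R) eta eta1 eta2 p px py pxx pxy pyy :
  bounded_wave B r eta eta1 eta2 p px py pxx pxy pyy ->
  forall x y, below eta x y -> continuity_2d_pt px x y.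
Proof.
  intros W x y Hxy. apply (continuity_of_C1 (below eta) px pxx pxy).
  - apply below_open; [eapply bw_eta_cont; eassumption|exact Hxy].
  - apply W.
  - apply W.
  - apply W, Hxy.
Qed.

Lemma bw_py_cont (B r : R) eta eta1 eta2 p px py pxx pxy pyy :
  bounded_wave B r eta eta1 eta2 p px py pxx pxy pyy ->
  forall x y, below eta x y -> continuity_2d_pt py x y.
Proof.
  intros W x y Hxy. apply (continuity_of_C1 (below eta) py pxy pyy).
  - apply below_open; [eapply bw_eta_cont; eassumption|exact Hxy].
  - apply W.
  - apply W.
  - apply W, Hxy.
Qed.

Lemma bw_p_cont (B r : R) eta eta1 eta2 p px py pxx pxy pyy :
  bounded_wave B r eta eta1 eta2 p px py pxx pxy pyy ->
  forall x y, below eta x y -> continuity_2d_pt p x y.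
Proof.
  intros W x y Hxy. apply (continuity_of_C1 (below eta) p px py).
  - apply below_open; [eapply bw_eta_cont; eassumption|exact Hxy].
  - apply W.
  - apply W.
  - eapply bw_px_cont; eassumption.
Qed.

(** At half depth [p] is at most [B * eta x / 2] by the bottom condition and at least
    [1 - B * eta x / 2] by the surface condition. *)
Lemma bw_depth (B r : R) eta eta1 eta2 p px py pxx pxy pyy :
  bounded_wave B r eta eta1 eta2 p px py pxx pxy pyy -> forall x, / B <= eta x.
Proof.
  intros W x. pose proof (bw_one W) as HB.
  pose proof (bw_eta_pos W x) as Hp.
  assert (Hb : below eta x (eta x / 2)) by (split; lra).
  assert (A1 := bw_bottom W Hb).
  assert (A2 := bw_surface W Hb).
  apply Rabs_le_between in A1, A2.
  assert (1 <= B * eta x) by lra.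
  apply (Rmult_le_reg_l B); [lra|]. rewrite Rinv_r; lra.
Qed.

(** At height [y] one has [|p| <= B y] along the whole horizontal line, and [px] is Lipschitz on it,
    so interpolation over a length [t] bounds [px] by [2 B y / t + B t]. Each term is made at most
    [e / 2], independently of [x]. *)
Lemma bw_px_bottom (B r : R) eta eta1 eta2 p px py pxx pxy pyy :
  bounded_wave B r eta eta1 eta2 p px py pxx pxy pyy ->
  forall e, 0 < e -> exists d, 0 < d /\
    forall x y, 0 < y < d -> below eta x y /\ Rabs (px x y) <= e.
Proof.
  intros W e He. pose proof (bw_one W) as HB.
  assert (HB' : 0 < / B) by (apply Rinv_0_lt_compat; lra).
  set (t := e / (2 * B)). assert (Ht : 0 < t) by (apply Rdiv_lt_0_compat; lra).
  set (d := e * t / (4 * B)).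
  assert (Hd : 0 < d) by (apply Rdiv_lt_0_compat; nra).
  exists (Rmin (/ B) d). split; [apply Rmin_glb_lt; assumption|].
  intros x y [Hy1 Hy2]. pose proof (Rmin_l (/ B) d). pose proof (Rmin_r (/ B) d).
  assert (Hbel : forall s, below eta s y).
  { intros s. pose proof (bw_depth W s). split; lra. }
  split; [apply Hbel|].
  eapply Rle_trans.
  { apply (small_derive_of_small (fun s => p s y) (fun s => px s y) x t (B * y) B Ht).
    - intros s _. apply W, Hbel.
    - intros s Hs. rewrite <- (Rabs_right (s - x)) by lra.
      apply (derive_bound_lipschitz (fun s => px s y) (fun s => pxx s y) (x - 1) (x + t + 1));
        try lra; intros; apply W, Hbel.
    - intros s _. apply W, Hbel. }
  assert (E1 : B * t = e / 2) by (unfold t; field; lra).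
  assert (E2 : 2 * (B * y) / t <= e / 2).
  { apply (Rmult_le_reg_r t); [exact Ht|].
    replace (2 * (B * y) / t * t) with (2 * B * y) by (field; lra).
    assert (E3 : 2 * B * d = e * t / 2) by (unfold d; field; lra).
    nra. }
  lra.
Qed.

Lemma bw_graph_below (B r : R) eta eta1 eta2 p px py pxx pxy pyy :
  bounded_wave B r eta eta1 eta2 p px py pxx pxy pyy ->
  forall x t, 0 < t < / B -> below eta x (eta x - t).
Proof.
  intros W x t Ht. pose proof (bw_depth W x). split; lra.
Qed.

(** The surface is approached by its vertical translates, which lie in the fluid for [t < / B];
    along them the chain rule is available. *)
Lemma bw_derive_along (B r : R) eta eta1 eta2 p px py pxx pxy pyy (f fx fy : R -> R -> R) :
  bounded_wave B r eta eta1 eta2 p px py pxx pxy pyy ->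
  (forall u v, below eta u v -> is_derive (fun s => f s v) u (fx u v)) ->
  (forall u v, below eta u v -> is_derive (fun t => f u t) v (fy u v)) ->
  (forall u v, below eta u v -> continuity_2d_pt fx u v) ->
  forall x t, 0 < t < / B ->
  is_derive (fun s => f s (eta s - t)) x
    (fx x (eta x - t) + fy x (eta x - t) * eta1 x).
Proof.
  intros W Hx Hy Hc x t Ht.
  assert (Hb := bw_graph_below W x Ht).
  apply (is_derive_along_graph (below eta) f fx fy (fun s => eta s - t)); auto.
  - apply below_open; [eapply bw_eta_cont; eassumption|exact Hb].
  - pose proof (bw_eta1 W x) as H1.
    evar_last; [apply (is_derive_minus eta (fun _ => t)); [exact H1|apply @is_derive_const]|].
    unfold minus, plus, opp, zero; simpl. ring.
Qed.

(** The same interpolation as at the bottom, applied to [p - 1] along a translate of the surface,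
    where it is at most [B t]. *)
Lemma bw_slope_near_surface (B r : R) eta eta1 eta2 p px py pxx pxy pyy :
  bounded_wave B r eta eta1 eta2 p px py pxx pxy pyy ->
  forall e, 0 < e -> exists d, 0 < d /\ d <= / B /\
    forall x t, 0 < t < d ->
      Rabs (px x (eta x - t) + py x (eta x - t) * eta1 x) <= e.
Proof.
  intros W e He. pose proof (bw_one W) as HB.
  assert (HB' : 0 < / B) by (apply Rinv_0_lt_compat; lra).
  (* Bounds the second derivative of [p] along the translate, term by term as it is written in [ddg]
     below. *)
  set (L := B + B * B + ((B + B * B) * B + B * B)).
  assert (HL : 0 < L) by (unfold L; nra).
  set (t := e / (2 * L)). assert (Ht : 0 < t) by (apply Rdiv_lt_0_compat; lra).
  set (d := e * t / (4 * B)).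
  assert (Hd : 0 < d) by (apply Rdiv_lt_0_compat; nra).
  exists (Rmin (/ B) d). split; [apply Rmin_glb_lt; assumption|split; [apply Rmin_l|]].
  intros x y [Hy1 Hy2]. pose proof (Rmin_l (/ B) d). pose proof (Rmin_r (/ B) d).
  assert (Hy : 0 < y < / B) by lra.
  assert (Hbel : forall s, below eta s (eta s - y))
    by (intros s; eapply bw_graph_below; eassumption).
  assert (dpx := bw_derive_along W
            (bw_pxx W) (bw_pxy W)
            (bw_pxx_cont W)).
  assert (dpy := bw_derive_along W
            (bw_pyx W) (bw_pyy W)
            (bw_pxy_cont W)).
  assert (dp := bw_derive_along W
            (bw_px W) (bw_py W)
            (bw_px_cont W)).
  set (dg := fun s => px s (eta s - y) + py s (eta s - y) * eta1 s).
  set (ddg := fun s => (pxx s (eta s - y) + pxy s (eta s - y) * eta1 s) +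
     ((pxy s (eta s - y) + pyy s (eta s - y) * eta1 s) * eta1 s + py s (eta s - y) * eta2 s)).
  eapply Rle_trans.
  { apply (small_derive_of_small (fun s => p s (eta s - y) - 1) dg x t (B * y) L Ht).
    - intros s _.
      replace (dg s) with (dg s - 0) by ring.
      apply (is_derive_minus (fun s => p s (eta s - y)) (fun _ => 1));
        [apply (dp s y Hy)|apply (is_derive_const 1)].
    - intros s Hs. rewrite <- (Rabs_right (s - x)) by lra.
      apply (derive_bound_lipschitz dg ddg (x - 1) (x + t + 1)); try lra.
      + intros z _. apply (is_derive_plus (fun s => px s (eta s - y))); [apply dpx, Hy|].
        evar_last; [apply (is_derive_mult (fun s => py s (eta s - y)) eta1);
                    [apply dpy, Hy|apply (bw_eta2 W)|intros; apply Rmult_comm]|].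
        unfold plus, mult; simpl. ring.
      + intros z _. specialize (Hbel z).
        unfold ddg, L. repeat first [apply Rabs_plus_le | apply Rabs_mult_le]; now apply W.
    - intros s _. replace y with (eta s - (eta s - y)) at 2 by ring. apply W, Hbel. }
  assert (E1 : L * t = e / 2) by (unfold t; field; lra).
  assert (E2 : 2 * (B * y) / t <= e / 2).
  { apply (Rmult_le_reg_r t); [exact Ht|].
    replace (2 * (B * y) / t * t) with (2 * B * y) by (field; lra).
    assert (E3 : 2 * B * d = e * t / 2) by (unfold d; field; lra).
    nra. }
  lra.
Qed.

(** Since [p] is constant on the surface, its tangential derivative vanishes in the limit, so the
    limiting gradient is normal to the surface. *)
Lemma bw_surface_velocity (B r : R) eta eta1 eta2 p px py pxx pxy pyy :
  bounded_wave B r eta eta1 eta2 p px py pxx pxy pyy ->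
  forall x, exists u v,
    (forall y, below eta x y -> Rabs (px x y - u) <= B * (eta x - y)) /\
    (forall y, below eta x y -> Rabs (py x y - v) <= B * (eta x - y)) /\
    u ^ 2 + v ^ 2 = 2 * (r - eta x) /\ u = - eta1 x * v.
Proof.
  intros W x. pose proof (bw_one W) as HB.
  destruct (bw_bernoulli W x) as [u [v [Hu [Hv E]]]].
  exists u, v. split; [exact Hu|split; [exact Hv|split; [lra|]]].
  apply cond_eq. intros e He.
  destruct (bw_slope_near_surface W (e := e / 4)) as [d [Hd [HdB Hs]]]; [lra|].
  set (t := Rmin (d / 2) (e / (4 * (B + B * B)))).
  assert (Ht : 0 < t) by (apply Rmin_glb_lt; [lra|apply Rdiv_lt_0_compat; nra]).
  pose proof (Rmin_l (d / 2) (e / (4 * (B + B * B)))) as T1.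
  pose proof (Rmin_r (d / 2) (e / (4 * (B + B * B)))) as T2. fold t in T1, T2.
  assert (Hb : below eta x (eta x - t)) by (eapply bw_graph_below; [eassumption|lra]).
  assert (A1 := Hu _ Hb). assert (A2 := Hv _ Hb). assert (A3 := Hs x t ltac:(lra)).
  replace (eta x - (eta x - t)) with t in A1, A2 by ring.
  assert (A4 := Rabs_mult_le A2 (bw_eta1_le W x)).
  assert (E5 : (B + B * B) * t <= e / 4).
  { replace (e / 4) with ((B + B * B) * (e / (4 * (B + B * B)))) by (field; nra).
    apply Rmult_le_compat_l; nra. }
  apply Rabs_le_between in A1, A3, A4. apply Rabs_def1; nra.
Qed.

(** Beyond [T] the bound is continued from [T / 2] without loss: [C T / 2 + C (t - T / 2) = C t]. *)
Lemma lipschitz_limit_extend (f : R -> R) (c C T h : R) :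
  0 < T -> T <= h ->
  (forall s t, 0 < s < h -> 0 < t < h -> Rabs (f s - f t) <= C * Rabs (s - t)) ->
  (forall t, 0 < t < T -> Rabs (f t - c) <= C * t) ->
  forall t, 0 < t < h -> Rabs (f t - c) <= C * t.
Proof.
  intros HT Hh HL Hc t Ht. destruct (Rlt_le_dec t T) as [Htt|Htt]; [apply Hc; lra|].
  assert (A1 := Hc (T / 2) ltac:(lra)). assert (A2 := HL t (T / 2) Ht ltac:(lra)).
  rewrite (Rabs_right (t - T / 2)) in A2 by lra.
  apply Rabs_le_between in A1, A2. apply Rabs_le. lra.
Qed.

Lemma square_trace_error (a u B t : R) :
  0 <= t <= 1 -> 1 <= B -> Rabs a <= B -> Rabs (a - u) <= B * t ->
  Rabs (a ^ 2 - u ^ 2) <= 3 * B ^ 2 * t.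
Proof.
  intros Ht HB Ha Hu.
  replace (a ^ 2 - u ^ 2) with ((a - u) * (a + u)) by ring.
  assert (Rabs (a + u) <= 3 * B).
  { apply Rabs_le_between in Ha, Hu. apply Rabs_le. nra. }
  eapply Rle_trans; [apply (Rabs_mult_le Hu H)|]. right; ring.
Qed.

(* [G] is half the imaginary part of a primitive of the squared complex velocity
   [(py + i px)^2], normalized to vanish on the bottom; [c] is [S - r^2/2]. *)
Lemma bw_flow_force_potential (B r : R) eta eta1 eta2 p px py pxx pxy pyy :
  bounded_wave B r eta eta1 eta2 p px py pxx pxy pyy ->
  exists (G : R -> R -> R) (c : R),
    (forall x y, below eta x y -> is_derive (fun s => G s y) x (px x y * py x y)) /\
    (forall x y, below eta x y ->
       is_derive (fun t => G x t) y (/ 2 * (py x y ^ 2 - px x y ^ 2))) /\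
    (forall x y, below eta x y -> Rabs (G x y) <= B ^ 2 * y) /\
    (forall x y, below eta x y ->
       Rabs (G x y - (c + / 2 * (r - eta x) ^ 2)) <= B ^ 2 * (eta x - y)).
Proof.
  intros W. pose proof (bw_one W) as HB.
  assert (HB' : 0 < / B) by (apply Rinv_0_lt_compat; lra).
  assert (HB1 : / B <= 1) by (rewrite <- Rinv_1; apply Rinv_le_contravar; lra).
  assert (cpx := bw_px_cont W). assert (cpy := bw_py_cont W).
  (* The height [/ B / 2] is inside the fluid for every [x], because all depths are at least
     [/ B]. *)
  destruct (@closed_form_primitive eta (/ B / 2) (fun x y => px x y * py x y)
    (fun x y => / 2 * (py x y ^ 2 - px x y ^ 2))
    (fun x y => py x y * pxy x y - px x y * pxx x y)) as [G HG].
  { apply (bw_eta_cont W). }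
  { intros x. pose proof (bw_depth W x). split; lra. }
  (* Closedness of the form is where the Laplace equation enters. *)
  { intros x y Hxy. pose proof (bw_laplace W Hxy) as HL.
    replace (py x y * pxy x y - px x y * pxx x y)
      with (pxy x y * py x y + px x y * pyy x y) by nra.
    apply (is_derive_mult (fun t => px x t) (fun t => py x t)).
    - apply (bw_pxy W Hxy).
    - apply (bw_pyy W Hxy).
    - apply Rmult_comm. }
  { intros x y Hxy.
    pose proof (bw_pyx W Hxy) as H1. pose proof (bw_pxx W Hxy) as H2.
    auto_derive; [split; [eexists; apply H1|split; [eexists; apply H2|exact I]]|].
    replace (Derive (fun s => py s y) x) with (pxy x y) by (symmetry; apply is_derive_unique, H1).
    replace (Derive (fun s => px s y) x) with (pxx x y) by (symmetry; apply is_derive_unique, H2).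
    field. }
  { intros x y Hxy. apply continuity_2d_pt_mult; auto. }
  { intros x y Hxy. simpl.
    apply continuity_2d_pt_mult; [apply continuity_2d_pt_const|].
    apply continuity_2d_pt_minus; repeat apply continuity_2d_pt_mult; auto;
      apply continuity_2d_pt_const. }
  { intros x y Hxy. apply continuity_2d_pt_minus; apply continuity_2d_pt_mult; auto; apply W, Hxy. }
  assert (HGy : forall x y, below eta x y -> Rabs (/ 2 * (py x y ^ 2 - px x y ^ 2)) <= B ^ 2).
  { intros x y Hxy. pose proof (bw_px_le W Hxy) as H1. pose proof (bw_py_le W Hxy) as H2.
    apply Rabs_le_between in H1, H2. apply Rabs_le. nra. }
  assert (Glip : forall x s t, 0 < s < eta x -> 0 < t < eta x ->
            Rabs (G x s - G x t) <= B ^ 2 * Rabs (s - t)).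
  { intros x. apply (@derive_bound_lipschitz (G x) (fun y => / 2 * (py x y ^ 2 - px x y ^ 2))).
    - intros t Ht. apply HG, Ht.
    - intros t Ht. apply HGy, Ht. }
  assert (Hin : forall x t, 0 < t < / B -> 0 < t < eta x)
    by (intros x t Ht; pose proof (bw_depth W x); lra).
  (* Near the bottom the tangential derivative [px * py] of [G] is small together with [px], so [G]
     has a constant limit [c0] there. *)
  destruct (@uniform_limit_constant G (fun x y => px x y * py x y) (/ B) (B ^ 2)) as [c0 Hc0].
  { exact HB'. }
  { intros x s t Hs Ht. apply Glip; apply Hin; assumption. }
  { intros x t Ht. apply HG, Hin, Ht. }
  { intros e He.
    destruct (bw_px_bottom W (e := e / B)) as [d [Hd1 Hd2]]; [apply Rdiv_lt_0_compat; lra|].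
    exists d. split; [exact Hd1|]. intros x t Ht _. destruct (Hd2 x t Ht) as [Hb Hs].
    replace e with (e / B * B) by (field; lra).
    apply Rabs_mult_le; [exact Hs|apply (bw_py_le W Hb)]. }
  assert (Hbot : forall x y, below eta x y -> Rabs (G x y - c0) <= B ^ 2 * y).
  { intros x y Hxy. apply (@lipschitz_limit_extend (G x) c0 (B ^ 2) (/ B) (eta x)); auto.
    apply (bw_depth W). }
  (* The difference between [G] on the translated surface and its expected surface value; it must
     tend to a constant, which is [c]. *)
  set (F := fun x t => G x (eta x - t) - c0 - / 2 * (r - eta x) ^ 2).
  set (Fx := fun x t => (px x (eta x - t) * py x (eta x - t) +
     / 2 * (py x (eta x - t) ^ 2 - px x (eta x - t) ^ 2) * eta1 x) + (r - eta x) * eta1 x).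
  assert (Flip : forall x s t, 0 < s < eta x -> 0 < t < eta x ->
            Rabs (F x s - F x t) <= B ^ 2 * Rabs (s - t)).
  { intros x s t Hs Ht. unfold F.
    replace (G x (eta x - s) - c0 - / 2 * (r - eta x) ^ 2 -
       (G x (eta x - t) - c0 - / 2 * (r - eta x) ^ 2))
      with (G x (eta x - s) - G x (eta x - t)) by ring.
    rewrite (Rabs_minus_sym s t). replace (t - s) with (eta x - s - (eta x - t)) by ring.
    apply Glip; lra. }
  destruct (@uniform_limit_constant F Fx (/ B) (B ^ 2)) as [c Hc].
  { exact HB'. }
  { intros x s t Hs Ht. apply Flip; apply Hin; assumption. }
  { intros x t Ht.
    assert (H1 : is_derive (fun s => G s (eta s - t)) x
       (px x (eta x - t) * py x (eta x - t) +
        / 2 * (py x (eta x - t) ^ 2 - px x (eta x - t) ^ 2) * eta1 x)).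
    { apply (bw_derive_along (f := G) (fx := fun x y => px x y * py x y)
        (fy := fun x y => / 2 * (py x y ^ 2 - px x y ^ 2)) W).
      - intros u v Huv. apply HG, Huv.
      - intros u v Huv. apply HG, Huv.
      - intros u v Huv. apply continuity_2d_pt_mult; auto.
      - exact Ht. }
    pose proof (bw_eta1 W x) as H2. unfold F, Fx.
    replace ((r - eta x) * eta1 x) with (- (/ 2 * (2 * (r - eta x) * (- eta1 x)))) by field.
    apply (is_derive_minus (fun s => G s (eta s - t) - c0)).
    - evar_last; [apply (is_derive_minus (fun s => G s (eta s - t)) (fun _ => c0));
                  [exact H1|apply (is_derive_const c0)]|].
      unfold minus, plus, opp, zero; simpl. ring.
    - auto_derive; [eexists; exact H2|].
      replace (Derive (fun x => eta x) x) with (eta1 x)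
        by (symmetry; apply is_derive_unique, H2).
      ring. }
  { intros e He.
    destruct (bw_slope_near_surface W (e := e / (2 * B))) as [d [Hd [HdB Hs]]].
    { apply Rdiv_lt_0_compat; lra. }
    assert (HB3 : 0 < 6 * B ^ 3) by (apply Rmult_lt_0_compat; [lra|apply pow_lt; lra]).
    exists (Rmin d (e / (6 * B ^ 3))). split.
    { apply Rmin_glb_lt; [exact Hd|apply Rdiv_lt_0_compat; lra]. }
    intros x t [Ht1 Ht2] HtB.
    pose proof (Rmin_l d (e / (6 * B ^ 3))). pose proof (Rmin_r d (e / (6 * B ^ 3))).
    assert (Hb : below eta x (eta x - t)) by (apply (bw_graph_below W); lra).
    destruct (bw_surface_velocity W x) as [u [v [Hu [Hv [Euv _]]]]].
    specialize (Hu _ Hb). specialize (Hv _ Hb).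
    replace (eta x - (eta x - t)) with t in Hu, Hv by ring.
    assert (A1 := square_trace_error (t := t) ltac:(lra) HB (bw_px_le W Hb) Hu).
    assert (A2 := square_trace_error (t := t) ltac:(lra) HB (bw_py_le W Hb) Hv).
    specialize (Hs x t ltac:(lra)).
    unfold Fx.
    set (a := px x (eta x - t)) in *. set (b := py x (eta x - t)) in *.
    (* With [r - eta = (u^2 + v^2) / 2] from Bernoulli's law, the tangential derivative is
       [b (a + b eta')] up to the errors [a^2 - u^2] and [b^2 - v^2]; the main term is small since
       [p] is constant on the surface. *)
    replace (a * b + / 2 * (b ^ 2 - a ^ 2) * eta1 x + (r - eta x) * eta1 x)
      with (b * (a + b * eta1 x) + - (/ 2 * ((a ^ 2 - u ^ 2) + (b ^ 2 - v ^ 2))) * eta1 x).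
    2: { replace (r - eta x) with (/ 2 * (u ^ 2 + v ^ 2)) by lra. field. }
    assert (Q1 : Rabs (- (/ 2 * ((a ^ 2 - u ^ 2) + (b ^ 2 - v ^ 2)))) <= 3 * B ^ 2 * t).
    { apply Rabs_le_between in A1, A2. apply Rabs_le. lra. }
    eapply Rle_trans.
    { apply Rabs_plus_le; apply Rabs_mult_le;
        [apply (bw_py_le W Hb)|exact Hs|exact Q1|apply (bw_eta1_le W)]. }
    assert (Q2 : B * (e / (2 * B)) = e / 2) by (field; lra).
    assert (Q3 : 3 * B ^ 2 * t * B <= e / 2).
    { replace (e / 2) with (3 * B ^ 3 * (e / (6 * B ^ 3))) by (field; lra).
      replace (3 * B ^ 2 * t * B) with (3 * B ^ 3 * t) by ring.
      apply Rmult_le_compat_l; lra. }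
    lra. }
  assert (Htop : forall x t, 0 < t < eta x -> Rabs (F x t - c) <= B ^ 2 * t).
  { intros x. apply (@lipschitz_limit_extend (F x) c (B ^ 2) (/ B) (eta x)); auto.
    apply (bw_depth W). }
  exists (fun x y => G x y - c0), c. split; [|split; [|split]].
  - intros x y Hxy. replace (px x y * py x y) with (px x y * py x y - 0) by ring.
    apply (is_derive_minus (fun s => G s y) (fun _ => c0));
      [apply HG, Hxy|apply (is_derive_const c0)].
  - intros x y Hxy.
    replace (/ 2 * (py x y ^ 2 - px x y ^ 2)) with (/ 2 * (py x y ^ 2 - px x y ^ 2) - 0) by ring.
    apply (is_derive_minus (fun t => G x t) (fun _ => c0));
      [apply HG, Hxy|apply (is_derive_const c0)].
  - exact Hbot.
  - intros x y [Hy1 Hy2]. assert (A := Htop x (eta x - y) ltac:(lra)).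
    unfold F in A. replace (eta x - (eta x - y)) with y in A by ring.
    replace (G x y - c0 - (c + / 2 * (r - eta x) ^ 2))
      with (G x y - c0 - / 2 * (r - eta x) ^ 2 - c) by ring.
    exact A.
Qed.

(** * Comparison functions *)

(** The two linear lower bounds stand for nonnegative boundary values of a function known only
    inside the fluid; [K] absorbs all rates of convergence. *)
Lemma bw_minimum_principle (B r : R) eta eta1 eta2 p px py pxx pxy pyy (K : R)
    (H Hx Hy Hxx Hyy : R -> R -> R) :
  bounded_wave B r eta eta1 eta2 p px py pxx pxy pyy ->
  0 <= K ->
  (forall x y, below eta x y -> is_derive (fun s => H s y) x (Hx x y)) ->
  (forall x y, below eta x y -> is_derive (fun s => Hx s y) x (Hxx x y)) ->
  (forall x y, below eta x y -> is_derive (fun t => H x t) y (Hy x y)) ->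
  (forall x y, below eta x y -> is_derive (fun t => Hy x t) y (Hyy x y)) ->
  (forall x y, below eta x y -> Hxx x y + Hyy x y <= 0) ->
  (forall x y, below eta x y -> continuity_2d_pt Hx x y) ->
  (forall x y, below eta x y -> - K * y <= H x y) ->
  (forall x y, below eta x y -> - K * (eta x - y) <= H x y) ->
  forall x y, below eta x y -> 0 <= H x y.
Proof.
  intros W HK dx dxx dy dyy Hlap Hc Hbot Htop. pose proof (bw_one W) as HB.
  assert (Hce := bw_eta_cont W).
  apply (superharmonic_nonneg (below eta) B (K * B) H Hx Hy Hxx Hyy); auto.
  - intros x y Hxy. apply below_open; auto.
  - intros x y [Hy1 Hy2]. pose proof (bw_eta_le W x). lra.
  - intros x y Hxy. apply (continuity_of_C1 (below eta) H Hx Hy); auto. apply below_open; auto.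
  - intros x y Hxy. pose proof (Hbot x y Hxy). pose proof (bw_eta_le W x).
    destruct Hxy. nra.
  - intros x y Hxy e.
    assert (He : 0 < e / (K + 1)) by (apply Rdiv_lt_0_compat; [apply cond_pos|lra]).
    assert (Ee : (K + 1) * (e / (K + 1)) = e) by (field; lra).
    destruct (Rle_lt_dec y 0) as [Hy0|Hy0].
    + exists (mkposreal _ He). intros u v Hu Hv Huv. simpl in Hv.
      pose proof (Hbot u v Huv). apply Rabs_def2 in Hv. destruct Huv. nra.
    + assert (Hye : eta x <= y) by (apply Rnot_lt_le; intro; apply Hxy; split; assumption).
      assert (He2 : 0 < e / (K + 1) / 2) by lra.
      destruct (proj1 (filterlim_locally _ _) (Hce x) (mkposreal _ He2)) as [d Hd].
      exists (mkposreal _ (Rmin_stable_in_posreal d (mkposreal _ He2))).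
      intros u v Hu Hv Huv. simpl in Hu, Hv.
      pose proof (Rmin_l d (e / (K + 1) / 2)). pose proof (Rmin_r d (e / (K + 1) / 2)).
      assert (A : Rabs (eta u - eta x) < e / (K + 1) / 2)
        by (apply (Hd u); change (Rabs (u - x) < d); lra).
      pose proof (Htop u v Huv). apply Rabs_def2 in A, Hv. destruct Huv. nra.
Qed.

(** The comparison functions [1 - p], [y - l p] and [h p - y] are all of this shape. The next lemmas
    keep the coefficients unsimplified where the result has to match [bw_affine_touching]. *)
Lemma bw_affine_nonneg (B r : R) eta eta1 eta2 p px py pxx pxy pyy (K k a b : R) :
  bounded_wave B r eta eta1 eta2 p px py pxx pxy pyy ->
  0 <= K ->
  (forall x y, below eta x y -> - K * y <= k + a * p x y + b * y) ->
  (forall x y, below eta x y -> - K * (eta x - y) <= k + a * p x y + b * y) ->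
  forall x y, below eta x y -> 0 <= k + a * p x y + b * y.
Proof.
  intros W HK Hbot Htop.
  apply (@bw_minimum_principle B r eta eta1 eta2 p px py pxx pxy pyy K
           (fun x y => k + a * p x y + b * y) (fun x y => a * px x y)
           (fun x y => a * py x y + b) (fun x y => a * pxx x y) (fun x y => a * pyy x y));
    auto.
  - intros x y Hxy. pose proof (bw_px W Hxy) as H1.
    auto_derive; [eexists; exact H1|].
    replace (Derive (fun x0 => p x0 y) x) with (px x y)
      by (symmetry; apply is_derive_unique, H1). ring.
  - intros x y Hxy. apply is_derive_scal, (bw_pxx W Hxy).
  - intros x y Hxy. pose proof (bw_py W Hxy) as H1.
    auto_derive; [eexists; exact H1|].
    replace (Derive (fun x0 => p x x0) y) with (py x y)
      by (symmetry; apply is_derive_unique, H1). ring.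
  - intros x y Hxy. pose proof (bw_pyy W Hxy) as H1.
    auto_derive; [eexists; exact H1|].
    replace (Derive (fun x0 => py x x0) y) with (pyy x y)
      by (symmetry; apply is_derive_unique, H1). ring.
  - intros x y Hxy. pose proof (bw_laplace W Hxy). nra.
  - intros x y Hxy. apply continuity_2d_pt_mult; [apply continuity_2d_pt_const|].
    apply (bw_px_cont W Hxy).
Qed.

Lemma bw_p_le_1 (B r : R) eta eta1 eta2 p px py pxx pxy pyy :
  bounded_wave B r eta eta1 eta2 p px py pxx pxy pyy ->
  forall x y, below eta x y -> p x y <= 1.
Proof.
  intros W x y Hxy. pose proof (bw_one W).
  enough (0 <= 1 + -1 * p x y + 0 * y) by lra. revert x y Hxy.
  apply (bw_affine_nonneg (K := B) W); [lra| |]; intros x y Hxy.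
  - pose proof (bw_bottom W Hxy) as A. apply Rabs_le_between in A. lra.
  - pose proof (bw_surface W Hxy) as A. apply Rabs_le_between in A. lra.
Qed.

Lemma bw_p_le_of_depth_ge (B r : R) eta eta1 eta2 p px py pxx pxy pyy (h : R) :
  bounded_wave B r eta eta1 eta2 p px py pxx pxy pyy ->
  0 <= h -> (forall x, h <= eta x) ->
  forall x y, below eta x y -> 0 <= 0 + - h * p x y + 1 * y.
Proof.
  intros W Hh Hle. pose proof (bw_one W).
  apply (bw_affine_nonneg (K := 1 + h * B) W); [nra| |]; intros x y Hxy.
  - pose proof (bw_bottom W Hxy) as A. apply Rabs_le_between in A. destruct Hxy. nra.
  - pose proof (bw_surface W Hxy) as A. apply Rabs_le_between in A.
    pose proof (Hle x). destruct Hxy. nra.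
Qed.

Lemma bw_p_ge_of_depth_le (B r : R) eta eta1 eta2 p px py pxx pxy pyy (h : R) :
  bounded_wave B r eta eta1 eta2 p px py pxx pxy pyy ->
  0 <= h -> (forall x, eta x <= h) ->
  forall x y, below eta x y -> 0 <= 0 + h * p x y + -1 * y.
Proof.
  intros W Hh Hle. pose proof (bw_one W).
  apply (bw_affine_nonneg (K := 1 + h * B) W); [nra| |]; intros x y Hxy.
  - pose proof (bw_bottom W Hxy) as A. apply Rabs_le_between in A. destruct Hxy. nra.
  - pose proof (bw_surface W Hxy) as A. apply Rabs_le_between in A.
    pose proof (Hle x). destruct Hxy. nra.
Qed.

Lemma bw_affine_touching (B r : R) eta eta1 eta2 p px py pxx pxy pyy (k a b : R) :
  bounded_wave B r eta eta1 eta2 p px py pxx pxy pyy ->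
  forall x v,
  (forall y, below eta x y -> 0 <= k + a * p x y + b * y) ->
  (forall y, below eta x y -> Rabs (py x y - v) <= B * (eta x - y)) ->
  forall t, 0 < t < / B ->
    (a * v + b) * t <= (k + a + b * eta x) + Rabs a * B * t ^ 2.
Proof.
  intros W x v Hpos Hv t Ht.
  apply (@derive_at_touching_end (fun y => k + a * p x y + b * y) (fun y => a * py x y + b)
           0 (eta x) _ _ (Rabs a * B + Rabs b)).
  - intros y Hy. pose proof (bw_py W (x := x) (y := y) Hy) as H1.
    auto_derive; [eexists; exact H1|].
    replace (Derive (fun x0 => p x x0) y) with (py x y)
      by (symmetry; apply is_derive_unique, H1). ring.
  - exact Hpos.
  - intros y Hy. pose proof (bw_surface W (x := x) (y := y) Hy) as A.
    replace (k + a * p x y + b * y - (k + a + b * eta x))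
      with (a * (p x y - 1) + b * - (eta x - y)) by ring.
    rewrite Rmult_plus_distr_r, Rmult_assoc.
    apply Rabs_plus_le; apply Rabs_mult_le; try apply Rle_refl; [exact A|].
    rewrite Rabs_Ropp, Rabs_right; lra.
  - intros y Hy. replace (a * py x y + b - (a * v + b)) with (a * (py x y - v)) by ring.
    rewrite Rmult_assoc. apply Rabs_mult_le; [apply Rle_refl|apply Hv, Hy].
  - pose proof (bw_depth W x). lra.
Qed.

(** Taking [t] with [L t <= e / 2] and then [d0 = e t / 2] settles the bound. As [d0] depends only
    on [T], [L] and [e], an almost extremal surface point can be chosen after it. *)
Lemma touching_slope_small (T L e : R) :
  0 < T -> 0 <= L -> 0 < e -> exists d0, 0 < d0 /\
    forall w d, d <= d0 -> (forall t, 0 < t < T -> w * t <= d + L * t ^ 2) -> w <= e.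
Proof.
  intros HT HL He.
  set (t := Rmin (T / 2) (e / (2 * (L + 1)))).
  assert (Ht : 0 < t) by (apply Rmin_glb_lt; [lra|apply Rdiv_lt_0_compat; lra]).
  pose proof (Rmin_l (T / 2) (e / (2 * (L + 1)))) as T1.
  pose proof (Rmin_r (T / 2) (e / (2 * (L + 1)))) as T2. fold t in T1, T2.
  exists (e * t / 2). split; [nra|]. intros w d Hd Hw.
  specialize (Hw t ltac:(lra)).
  assert (E : (L + 1) * (e / (2 * (L + 1))) = e / 2) by (field; lra).
  assert (A : L * t <= e / 2) by nra.
  apply (Rmult_le_reg_r t); [exact Ht|]. nra.
Qed.

(** A larger slope, varying by at most [B t], would lift the surface above [h] within distance [t]
    on the uphill side. *)
Lemma bw_slope_at_crest (B r : R) eta eta1 eta2 p px py pxx pxy pyy (h : R) :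
  bounded_wave B r eta eta1 eta2 p px py pxx pxy pyy ->
  (forall x, eta x <= h) ->
  forall x t, 0 < t -> Rabs (eta1 x) * t <= (h - eta x) + B * t ^ 2.
Proof.
  intros W Hle x t Ht. pose proof (bw_one W) as HB.
  assert (Hlip : forall s, x - t <= s <= x + t -> Rabs (eta1 s - eta1 x) <= B * t).
  { intros s Hs. apply Rle_trans with (B * Rabs (s - x)).
    - apply (@derive_bound_lipschitz eta1 eta2 (x - t - 1) (x + t + 1)); try lra;
        intros; [apply (bw_eta2 W)|apply (bw_eta2_le W)].
    - apply Rmult_le_compat_l; [lra|]. apply Rabs_le; lra. }
  destruct (@is_derive_MVT eta eta1 x (x + t)) as [c [Hc Ec]];
    [lra|intros; apply (bw_eta1 W)|].
  destruct (@is_derive_MVT eta eta1 (x - t) x) as [c' [Hc' Ec']];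
    [lra|intros; apply (bw_eta1 W)|].
  assert (A1 := Hlip c ltac:(lra)). assert (A2 := Hlip c' ltac:(lra)).
  apply Rabs_le_between in A1, A2.
  pose proof (Hle (x + t)). pose proof (Hle (x - t)).
  unfold Rabs. destruct (Rcase_abs (eta1 x)); nra.
Qed.

(** From [cos u = 1 - 2 sin^2 (u / 2)], the bound [sin v >= v / sqrt 2] on [[0, PI / 4]] and
    [1 - z <= exp (- z)]. It is what confines the positivity set of the barrier to the region below
    a parabola. *)
Lemma cos_le_exp_quadratic (u : R) : Rabs u <= PI / 2 -> cos u <= exp (- (u ^ 2 / 4)).
Proof.
  intros Hu. pose proof PI_RGT_0 as Hpi.
  assert (Hsin : forall v, 0 <= v <= PI / 4 -> v ^ 2 / 2 <= sin v ^ 2).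
  { intros v Hv. destruct (Rle_lt_or_eq_dec 0 v (proj1 Hv)) as [Hv0|<-].
    2: { rewrite sin_0. lra. }
    destruct (@is_derive_MVT sin cos 0 v Hv0) as [c [Hc E]].
    { intros t _. apply is_derive_Reals, derivable_pt_lim_sin. }
    rewrite sin_0, !Rminus_0_r in E. rewrite E.
    assert (Hcos : cos (PI / 4) <= cos c) by (apply cos_decr_1; lra).
    assert (H4 : cos (PI / 4) ^ 2 = / 2).
    { rewrite cos_PI4. unfold Rdiv. rewrite Rmult_1_l, pow_inv.
      change (/ (sqrt 2 * (sqrt 2 * 1)) = / 2). rewrite Rmult_1_r, sqrt_sqrt; lra. }
    assert (H40 : 0 <= cos (PI / 4)) by (apply cos_ge_0; lra).
    assert (/ 2 <= cos c ^ 2) by (rewrite <- H4; apply pow_incr; lra).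
    rewrite Rpow_mult_distr. nra. }
  assert (Hq : u ^ 2 / 8 <= sin (u / 2) ^ 2).
  { destruct (Rle_lt_dec 0 u) as [H0|H0].
    - rewrite Rabs_right in Hu by lra. specialize (Hsin (u / 2) ltac:(lra)). lra.
    - rewrite Rabs_left in Hu by lra. specialize (Hsin (- (u / 2)) ltac:(lra)).
      rewrite sin_neg in Hsin. lra. }
  assert (E : cos u = 1 - 2 * sin (u / 2) ^ 2).
  { replace u with (2 * (u / 2)) at 1 by field. rewrite cos_2a_sin. ring. }
  pose proof (exp_ineq1_le (- (u ^ 2 / 4))). lra.
Qed.

Lemma continuity_2d_pt_exp_cos (a k x0 Y0 x y : R) :
  continuity_2d_pt (fun u v => a * (exp (k * (Y0 - v)) * cos (k * (u - x0)))) x y.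
Proof.
  apply continuity_2d_pt_mult; [apply continuity_2d_pt_const|].
  apply continuity_2d_pt_mult.
  - apply (continuity_1d_2d_pt_comp exp).
    + apply derivable_continuous_pt, derivable_pt_exp.
    + apply continuity_2d_pt_mult; [apply continuity_2d_pt_const|].
      apply continuity_2d_pt_minus; [apply continuity_2d_pt_const|apply continuity_2d_pt_id2].
  - apply (continuity_1d_2d_pt_comp cos).
    + apply derivable_continuous_pt, derivable_pt_cos.
    + apply continuity_2d_pt_mult; [apply continuity_2d_pt_const|].
      apply continuity_2d_pt_minus; [apply continuity_2d_pt_id1|apply continuity_2d_pt_const].
Qed.

(* The harmonic function [exp (k (Y0 - y)) cos (k (x - x0)) - 1] is positive only
   in a channel of width [PI / k] and below the parabola [y = Y0 - k (x - x0)^2 / 4],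
   hence inside the fluid: it serves as a Hopf barrier. *)
Lemma bw_barrier (B r : R) eta eta1 eta2 p px py pxx pxy pyy (k x0 Y0 : R) :
  bounded_wave B r eta eta1 eta2 p px py pxx pxy pyy ->
  0 < k -> (forall x, Y0 - k / 4 * (x - x0) ^ 2 <= eta x) ->
  forall y, 0 < y < Y0 -> p x0 y <= 1 - exp (- (k * B)) * (k * (Y0 - y)).
Proof.
  intros W Hk Hle. pose proof (bw_one W) as HB. pose proof PI_RGT_0 as Hpi.
  (* The scaling that keeps [Ef <= 1] for [y >= 0], because [Y0 <= B]. *)
  set (ep := exp (- (k * B))). assert (Hep : 0 < ep) by apply exp_pos.
  set (Ef := fun x y => ep * (exp (k * (Y0 - y)) * cos (k * (x - x0)))).
  (* The middle condition selects one period of the cosine, the channel around [x0]. *)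
  set (D := fun x y => 0 < y /\ k * Rabs (x - x0) < PI / 2 /\ ep < Ef x y).
  assert (HkX : forall x, Rabs (k * (x - x0)) = k * Rabs (x - x0)).
  { intros x. rewrite Rabs_mult, (Rabs_right k); lra. }
  assert (HDb : forall x y, D x y -> below eta x y).
  { intros x y [Hy [Hx HE]]. split; [exact Hy|].
    assert (Hc := @cos_le_exp_quadratic (k * (x - x0)) ltac:(rewrite HkX; lra)).
    assert (H1 : 1 < exp (k * (Y0 - y) + - ((k * (x - x0)) ^ 2 / 4))).
    { rewrite exp_plus. apply (Rmult_lt_reg_l ep); [exact Hep|]. rewrite Rmult_1_r.
      eapply Rlt_le_trans; [exact HE|]. unfold Ef.
      apply Rmult_le_compat_l; [lra|]. apply Rmult_le_compat_l; [left; apply exp_pos|exact Hc]. }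
    rewrite <- exp_0 in H1. apply exp_lt_inv in H1.
    pose proof (Hle x).
    assert (0 < Y0 - y - k / 4 * (x - x0) ^ 2); [|lra].
    apply (Rmult_lt_reg_l k); [exact Hk|]. lra. }
  assert (HY0 : Y0 <= B).
  { pose proof (Hle x0) as A. pose proof (bw_eta_le W x0). rewrite Rminus_diag in A. lra. }
  assert (HE1 : forall x y, 0 <= y -> Ef x y <= 1).
  { intros x y Hy. unfold Ef, ep. rewrite <- Rmult_assoc, <- exp_plus.
    rewrite <- (Rmult_1_r 1).
    apply Rle_trans with (exp (- (k * B) + k * (Y0 - y)) * 1).
    - apply Rmult_le_compat_l; [left; apply exp_pos|apply COS_bound].
    - apply Rmult_le_compat_r; [lra|].
      assert (A : - (k * B) + k * (Y0 - y) <= 0) by nra.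
      rewrite <- exp_0. destruct (Rle_lt_or_eq_dec _ _ A) as [A'|A'].
      + left. apply exp_increasing, A'.
      + rewrite A'. lra. }
  assert (HEc : forall x y, continuity_2d_pt Ef x y)
    by (intros; apply continuity_2d_pt_exp_cos).
  assert (HDo : forall x y, D x y -> locally_2d D x y).
  { intros x y [Hy [Hx HE]].
    assert (He1 : 0 < Ef x y - ep) by lra.
    destruct (HEc x y (mkposreal _ He1)) as [d1 Hd1]. simpl in Hd1.
    assert (He2 : 0 < Rmin y ((PI / 2 - k * Rabs (x - x0)) / k)).
    { apply Rmin_glb_lt; [exact Hy|apply Rdiv_lt_0_compat; lra]. }
    exists (mkposreal _ (Rmin_stable_in_posreal d1 (mkposreal _ He2))). simpl.
    set (d2 := Rmin y ((PI / 2 - k * Rabs (x - x0)) / k)) in *.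
    pose proof (Rmin_l d1 d2). pose proof (Rmin_r d1 d2).
    assert (D1 : d2 <= y) by apply Rmin_l.
    assert (D2 : k * d2 <= PI / 2 - k * Rabs (x - x0)).
    { replace (PI / 2 - k * Rabs (x - x0)) with (k * ((PI / 2 - k * Rabs (x - x0)) / k))
        by (field; lra).
      apply Rmult_le_compat_l; [lra|apply Rmin_r]. }
    intros u v Hu Hv. repeat split.
    - apply Rabs_def2 in Hv. lra.
    - assert (A : Rabs (u - x0) <= Rabs (u - x) + Rabs (x - x0)).
      { replace (u - x0) with ((u - x) + (x - x0)) by ring. apply Rabs_triang. }
      nra.
    - assert (A := Hd1 u v ltac:(lra) ltac:(lra)). apply Rabs_def2 in A. lra. }
  (* Boundary values: on the bottom [p] vanishes and [Ef <= 1]; elsewhere on the boundary of [D] one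
     has [Ef <= ep] and [p <= 1]. *)
  assert (Hpos : forall x y, D x y -> 0 <= 1 + ep - Ef x y - p x y).
  { apply (@superharmonic_nonneg D B 1 (fun x y => 1 + ep - Ef x y - p x y)
      (fun x y => ep * (exp (k * (Y0 - y)) * (k * sin (k * (x - x0)))) - px x y)
      (fun x y => ep * (k * exp (k * (Y0 - y)) * cos (k * (x - x0))) - py x y)
      (fun x y => ep * (exp (k * (Y0 - y)) * (k * (k * cos (k * (x - x0))))) - pxx x y)
      (fun x y => ep * (- k * (k * exp (k * (Y0 - y))) * cos (k * (x - x0))) - pyy x y)).
    - exact HDo.
    - intros x y Hxy. pose proof (bw_eta_le W x). apply HDb in Hxy. destruct Hxy. lra.
    - intros x y Hxy. pose proof (bw_px W (HDb _ _ Hxy)) as H1. unfold Ef.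
      auto_derive; [eexists; exact H1|].
      replace (Derive (fun x1 => p x1 y) x) with (px x y)
        by (symmetry; apply is_derive_unique, H1). unfold Rminus. ring.
    - intros x y Hxy. pose proof (bw_pxx W (HDb _ _ Hxy)) as H1.
      auto_derive; [eexists; exact H1|].
      replace (Derive (fun x1 => px x1 y) x) with (pxx x y)
        by (symmetry; apply is_derive_unique, H1). unfold Rminus. ring.
    - intros x y Hxy. pose proof (bw_py W (HDb _ _ Hxy)) as H1. unfold Ef.
      auto_derive; [eexists; exact H1|].
      replace (Derive (fun x1 => p x x1) y) with (py x y)
        by (symmetry; apply is_derive_unique, H1). unfold Rminus. ring.
    - intros x y Hxy. pose proof (bw_pyy W (HDb _ _ Hxy)) as H1.
      auto_derive; [eexists; exact H1|].
      replace (Derive (fun x1 => py x x1) y) with (pyy x y)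
        by (symmetry; apply is_derive_unique, H1). unfold Rminus. ring.
    - intros x y Hxy. pose proof (bw_laplace W (HDb _ _ Hxy)). nra.
    - intros x y Hxy. apply continuity_2d_pt_minus; [|apply (bw_p_cont W), HDb, Hxy].
      apply continuity_2d_pt_minus; [apply continuity_2d_pt_const|apply HEc].
    - intros x y Hxy. pose proof (bw_p_le_1 W (HDb _ _ Hxy)).
      pose proof (HE1 x y ltac:(destruct Hxy; lra)). lra.
    - intros x y Hxy e. pose proof (cond_pos e) as He.
      destruct (Rle_lt_dec y 0) as [Hy0|Hy0].
      { assert (HeB : 0 < e / B) by (apply Rdiv_lt_0_compat; lra).
        exists (mkposreal _ HeB). intros u v Hu Hv Huv. simpl in Hv.
        pose proof (bw_bottom W (HDb _ _ Huv)) as A. apply Rabs_le_between in A.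
        pose proof (HE1 u v ltac:(destruct Huv; lra)).
        assert (B * v <= e).
        { apply Rabs_def2 in Hv. replace (pos e) with (B * (e / B)) by (field; lra).
          apply Rmult_le_compat_l; lra. }
        lra. }
      destruct (Rle_lt_dec (k * Rabs (x - x0)) (PI / 2)) as [Hx|Hx].
      + assert (HEle : Ef x y <= ep).
        { destruct (Rle_lt_or_eq_dec _ _ Hx) as [Hx'|Hx'].
          - apply Rnot_lt_le. intro. apply Hxy. repeat split; assumption.
          - unfold Ef. assert (E0 : cos (k * (x - x0)) = 0).
            { rewrite <- HkX in Hx'. unfold Rabs in Hx'. destruct Rcase_abs.
              - rewrite <- cos_neg, Hx'. apply cos_PI2.
              - rewrite Hx'. apply cos_PI2. }
            rewrite E0, !Rmult_0_r. lra. }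
        destruct (HEc x y e) as [d Hd]. exists d. intros u v Hu Hv Huv.
        assert (A := Hd u v Hu Hv). apply Rabs_def2 in A.
        pose proof (bw_p_le_1 W (HDb _ _ Huv)). lra.
      + assert (Hd : 0 < (k * Rabs (x - x0) - PI / 2) / k) by (apply Rdiv_lt_0_compat; lra).
        exists (mkposreal _ Hd). intros u v Hu _ [_ [Hu2 _]]. exfalso. simpl in Hu.
        assert (A : Rabs (x - x0) <= Rabs (u - x) + Rabs (u - x0)).
        { replace (x - x0) with (- (u - x) + (u - x0)) by ring.
          eapply Rle_trans; [apply Rabs_triang|]. rewrite Rabs_Ropp. lra. }
        assert (E : k * ((k * Rabs (x - x0) - PI / 2) / k) = k * Rabs (x - x0) - PI / 2)
          by (field; lra).
        nra. }
  intros y Hy.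
  assert (E0 : Ef x0 y = ep * exp (k * (Y0 - y))).
  { unfold Ef. rewrite Rminus_diag, Rmult_0_r, cos_0. ring. }
  (* On the axis, [exp z - 1 > z] turns the barrier into a linear gap between [p] and 1. *)
  assert (Hexp := exp_ineq1 (k * (Y0 - y)) ltac:(nra)).
  assert (HD0 : D x0 y).
  { split; [lra|]. rewrite Rminus_diag, Rabs_R0. split; [lra|]. rewrite E0.
    assert (0 < k * (Y0 - y)) by nra. nra. }
  pose proof (Hpos _ _ HD0) as A. rewrite E0 in A. nra.
Qed.

(** A Hopf lemma uniform over almost highest points. At such a point the slope need not vanish, so
    the apex of the barrier is lowered by [q^2] to make its parabola fit under the surface. The
    price is a touching defect [ek * q^2], harmless for small [q]. *)
Lemma bw_crest_speed_pos (B r : R) eta eta1 eta2 p px py pxx pxy pyy (h : R) :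
  bounded_wave B r eta eta1 eta2 p px py pxx pxy pyy ->
  (forall x, eta x <= h) ->
  exists s d, 0 < s /\ 0 < d /\ forall x v,
    (forall y, below eta x y -> Rabs (py x y - v) <= B * (eta x - y)) ->
    h - eta x <= d -> s <= v.
Proof.
  intros W Hle. pose proof (bw_one W) as HB.
  assert (HB' : 0 < / B) by (apply Rinv_0_lt_compat; lra).
  (* So that [k / 4 = (1 + B)^2] dominates both the curvature bound and the quadratic part left when
     the slope term [(1 + B) q |X|] is split between [q^2] and [X^2]. *)
  set (k := 4 * (1 + B) ^ 2). assert (Hk : 0 < k) by (unfold k; nra).
  set (ek := exp (- (k * B)) * k).
  assert (Hek : 0 < ek) by (apply Rmult_lt_0_compat; [apply exp_pos|exact Hk]).
  destruct (@touching_slope_small (/ B) B (ek / 2)) as [d0 [Hd0 Htouch]]; try lra.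
  set (q := Rmin 1 (d0 / ek)).
  assert (Hq : 0 < q) by (apply Rmin_glb_lt; [lra|apply Rdiv_lt_0_compat; lra]).
  assert (Hq1 : q <= 1) by apply Rmin_l.
  assert (Hq2 : ek * q <= d0).
  { replace d0 with (ek * (d0 / ek)) by (field; lra).
    apply Rmult_le_compat_l; [lra|apply Rmin_r]. }
  exists (ek / 2), (q ^ 2). split; [lra|]. split; [nra|].
  intros x v Hv Hx.
  assert (Hslope : Rabs (eta1 x) <= (1 + B) * q).
  { pose proof (bw_slope_at_crest W Hle x Hq) as A.
    apply (Rmult_le_reg_r q); [exact Hq|]. nra. }
  set (Y0 := eta x - q ^ 2).
  assert (Hpar : forall z, Y0 - k / 4 * (z - x) ^ 2 <= eta z).
  { intros z. set (X := z - x).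
    assert (Hz : eta z >= eta x - Rabs (eta1 x) * Rabs X - B * X ^ 2).
    { assert (Hl : forall c, Rabs (c - x) <= Rabs X -> Rabs (eta1 c - eta1 x) <= B * Rabs X).
      { intros c Hc. apply Rle_trans with (B * Rabs (c - x)); [|apply Rmult_le_compat_l; lra].
        apply Rabs_le_between in Hc. pose proof (Rabs_pos X).
        apply (@derive_bound_lipschitz eta1 eta2 (x - Rabs X - 1) (x + Rabs X + 1)); try lra;
          intros; [apply (bw_eta2 W)|apply (bw_eta2_le W)]. }
      assert (Hm : exists c, Rabs (c - x) <= Rabs X /\ eta z - eta x = eta1 c * X).
      { unfold X. destruct (Rtotal_order x z) as [Hlt|[->|Hlt]].
        - destruct (@is_derive_MVT eta eta1 x z Hlt) as [c [Hc E]];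
            [intros; apply (bw_eta1 W)|].
          exists c. split; [rewrite !Rabs_right; lra|exact E].
        - exists z. split; [lra|ring].
        - destruct (@is_derive_MVT eta eta1 z x Hlt) as [c [Hc E]];
            [intros; apply (bw_eta1 W)|].
          exists c. split; [rewrite !Rabs_left; lra|lra]. }
      destruct Hm as [c [Hc E]].
      assert (A := Hl c Hc).
      assert (A2 : Rabs (eta1 c * X) <= (Rabs (eta1 x) + B * Rabs X) * Rabs X).
      { apply Rabs_mult_le; [|lra]. replace (eta1 c) with (eta1 x + (eta1 c - eta1 x)) by ring.
        apply Rabs_plus_le; lra. }
      apply Rabs_le_between in A2. rewrite <- (pow2_abs X). rewrite <- E in A2. nra. }
    unfold Y0, k. pose proof (Rabs_pos X). rewrite <- (pow2_abs X) in Hz |- *.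
    assert (A : Rabs (eta1 x) * Rabs X <= (1 + B) * q * Rabs X)
      by (apply Rmult_le_compat_r; lra).
    pose proof (pow2_ge_0 (2 * q - (1 + B) * Rabs X)). nra. }
  assert (Hbar := bw_barrier W Hk Hpar).
  (* The function is [1 - p - ek (Y0 - y)]: nonnegative by the barrier below [Y0] and by [p <= 1]
     above it, with surface value [ek * q ^ 2]. *)
  assert (Htou := @bw_affine_touching _ _ _ _ _ _ _ _ _ _ _ (1 - ek * Y0) (-1) ek W x v).
  enough (-1 * v + ek <= ek / 2) by lra.
  apply (Htouch _ (ek * q ^ 2)).
  - assert (q ^ 2 <= q) by nra. nra.
  - intros t Ht. eapply Rle_trans; [apply Htou; [|exact Hv|exact Ht]|].
    + intros y Hy. destruct (Rlt_le_dec y Y0) as [HyY|HyY].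
      * pose proof (Hbar y ltac:(destruct Hy; lra)) as A. unfold ek. nra.
      * pose proof (bw_p_le_1 W Hy). nra.
    + rewrite Rabs_left by lra. unfold Y0. right. ring.
Qed.

(** * Estimates at crests and troughs *)

(** The antiderivative [G - y^2 / 2 + r y] rises from 0 to [c + (r - eta)^2 / 2 - eta^2 / 2 + r eta
    = c + r^2 / 2]. The depth cancels, so the integral is the same for all [x]. *)
Lemma bw_flow_force_integral (B r : R) eta eta1 eta2 p px py pxx pxy pyy
    (G : R -> R -> R) (c : R) :
  bounded_wave B r eta eta1 eta2 p px py pxx pxy pyy ->
  (forall x y, below eta x y ->
     is_derive (fun t => G x t) y (/ 2 * (py x y ^ 2 - px x y ^ 2))) ->
  (forall x y, below eta x y -> Rabs (G x y) <= B ^ 2 * y) ->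
  (forall x y, below eta x y ->
     Rabs (G x y - (c + / 2 * (r - eta x) ^ 2)) <= B ^ 2 * (eta x - y)) ->
  forall x, is_RInt (fun y => / 2 * (py x y ^ 2 - px x y ^ 2) - y + r) 0 (eta x)
              (c + / 2 * r ^ 2).
Proof.
  intros W HGy HGb HGt x. pose proof (bw_one W) as HB.
  pose proof (bw_eta_le W x) as HxB. pose proof (bw_eta_pos W x) as Hx0.
  replace (c + / 2 * r ^ 2) with (c + / 2 * r ^ 2 - 0) by ring.
  apply (@is_RInt_primitive_open (fun y => G x y - y ^ 2 / 2 + r * y) _ 0 (eta x) 0 _
           (B ^ 2 + (Rabs r + B)) (B * B + B * B + 1) Hx0).
  - intros y Hy. pose proof (HGy x y Hy) as H1.
    auto_derive; [eexists; exact H1|].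
    replace (Derive (fun x0 => G x x0) y) with (/ 2 * (py x y ^ 2 - px x y ^ 2))
      by (symmetry; apply is_derive_unique, H1). field.
  - apply (@derive_bound_lipschitz _ (fun y => py x y * pyy x y - px x y * pxy x y - 1)).
    + intros y Hy. pose proof (bw_pyy W (x := x) (y := y) Hy) as H1.
      pose proof (bw_pxy W (x := x) (y := y) Hy) as H2.
      auto_derive; [split; [eexists; exact H1|split; [eexists; exact H2|exact I]]|].
      replace (Derive (fun x0 => py x x0) y) with (pyy x y)
        by (symmetry; apply is_derive_unique, H1).
      replace (Derive (fun x0 => px x x0) y) with (pxy x y)
        by (symmetry; apply is_derive_unique, H2). field.
    + intros y Hy. unfold Rminus.
      apply Rabs_plus_le; [apply Rabs_plus_le|].
      * apply Rabs_mult_le; [apply (bw_py_le W Hy)|apply (bw_pyy_le W Hy)].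
      * rewrite Rabs_Ropp. apply Rabs_mult_le; [apply (bw_px_le W Hy)|apply (bw_pxy_le W Hy)].
      * rewrite Rabs_Ropp, Rabs_R1. lra.
  - intros y Hy. pose proof (HGb x y Hy) as A.
    replace (G x y - y ^ 2 / 2 + r * y - 0) with (G x y + (r - y / 2) * y) by field.
    rewrite Rminus_0_r, (Rmult_plus_distr_r (B ^ 2)). apply Rabs_plus_le; [exact A|].
    apply Rabs_mult_le; [|rewrite Rabs_right; lra].
    apply Rabs_plus_le; [lra|]. rewrite Rabs_Ropp, Rabs_right; lra.
  - intros y Hy. pose proof (HGt x y Hy) as A.
    replace (G x y - y ^ 2 / 2 + r * y - (c + / 2 * r ^ 2))
      with (G x y - (c + / 2 * (r - eta x) ^ 2) + (- r + (eta x + y) / 2) * (eta x - y))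
      by field.
    rewrite (Rmult_plus_distr_r (B ^ 2)). apply Rabs_plus_le; [exact A|].
    apply Rabs_mult_le; [|rewrite Rabs_right; lra].
    apply Rabs_plus_le; [rewrite Rabs_Ropp; lra|]. rewrite Rabs_right; lra.
Qed.

(** The function [G - m p] is nonnegative by the minimum principle. Its surface value
    [((r - eta)^2 - (r - h)^2) / 2] is at most [r (h - eta)], and its vertical derivative there is
    [(v^2 - u^2) / 2 - m v]. *)
Lemma bw_flow_force_touching (B r : R) eta eta1 eta2 p px py pxx pxy pyy
    (G : R -> R -> R) (c h : R) :
  bounded_wave B r eta eta1 eta2 p px py pxx pxy pyy ->
  (forall x y, below eta x y -> is_derive (fun s => G s y) x (px x y * py x y)) ->
  (forall x y, below eta x y ->
     is_derive (fun t => G x t) y (/ 2 * (py x y ^ 2 - px x y ^ 2))) ->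
  (forall x y, below eta x y -> Rabs (G x y) <= B ^ 2 * y) ->
  (forall x y, below eta x y ->
     Rabs (G x y - (c + / 2 * (r - eta x) ^ 2)) <= B ^ 2 * (eta x - y)) ->
  (forall x, eta x <= h) -> h <= r ->
  forall x u v,
  (forall y, below eta x y -> Rabs (px x y - u) <= B * (eta x - y)) ->
  (forall y, below eta x y -> Rabs (py x y - v) <= B * (eta x - y)) ->
  forall t, 0 < t < / B ->
  (/ 2 * (v ^ 2 - u ^ 2) - (c + / 2 * (r - h) ^ 2) * v) * t
    <= r * (h - eta x) + (3 * B ^ 2 + Rabs (c + / 2 * (r - h) ^ 2) * B) * t ^ 2.
Proof.
  intros W HGx HGy HGb HGt Hle Hr x u v Hu Hv t Ht. pose proof (bw_one W) as HB.
  assert (HB' : 0 < / B) by (apply Rinv_0_lt_compat; lra).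
  assert (HB1 : / B <= 1) by (rewrite <- Rinv_1; apply Rinv_le_contravar; lra).
  set (m := c + / 2 * (r - h) ^ 2).
  assert (Hpos : forall x y, below eta x y -> 0 <= G x y - m * p x y).
  { assert (HK : 0 <= B ^ 2 + Rabs m * B) by (pose proof (Rabs_pos m); nra).
    apply (@bw_minimum_principle B r eta eta1 eta2 p px py pxx pxy pyy _
      (fun x y => G x y - m * p x y) (fun x y => px x y * py x y - m * px x y)
      (fun x y => / 2 * (py x y ^ 2 - px x y ^ 2) - m * py x y)
      (fun x y => pxx x y * py x y + px x y * pxy x y - m * pxx x y)
      (fun x y => py x y * pyy x y - px x y * pxy x y - m * pyy x y) W HK).
    - intros z y Hzy. pose proof (HGx z y Hzy) as H1. pose proof (bw_px W Hzy) as H2.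
      apply (is_derive_minus (fun s => G s y) (fun s => m * p s y)); [exact H1|].
      apply is_derive_scal, H2.
    - intros z y Hzy. pose proof (bw_pxx W Hzy) as H1. pose proof (bw_pyx W Hzy) as H2.
      apply (is_derive_minus (fun s => px s y * py s y) (fun s => m * px s y)).
      + apply (is_derive_mult (fun s => px s y) (fun s => py s y)); auto. apply Rmult_comm.
      + apply is_derive_scal, H1.
    - intros z y Hzy. pose proof (HGy z y Hzy) as H1. pose proof (bw_py W Hzy) as H2.
      apply (is_derive_minus (fun s => G z s) (fun s => m * p z s)); [exact H1|].
      apply is_derive_scal, H2.
    - intros z y Hzy. pose proof (bw_pxy W Hzy) as H1. pose proof (bw_pyy W Hzy) as H2.
      auto_derive; [repeat split; eexists; first [exact H1|exact H2]|].
      replace (Derive (fun x0 => py z x0) y) with (pyy z y)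
        by (symmetry; apply is_derive_unique, H2).
      replace (Derive (fun x0 => px z x0) y) with (pxy z y)
        by (symmetry; apply is_derive_unique, H1). field.
    - intros z y Hzy. pose proof (bw_laplace W Hzy) as H1.
      replace (pyy z y) with (- pxx z y) by lra. right. ring.
    - intros z y Hzy. pose proof (bw_px_cont W Hzy). pose proof (bw_py_cont W Hzy).
      apply continuity_2d_pt_minus; apply continuity_2d_pt_mult; auto.
      apply continuity_2d_pt_const.
    - intros z y Hzy. pose proof (HGb z y Hzy) as A1.
      pose proof (Rabs_mult_le (Rle_refl (Rabs m)) (bw_bottom W Hzy)) as A2.
      apply Rabs_le_between in A1, A2. lra.
    - intros z y Hzy. pose proof (HGt z y Hzy) as A1.
      pose proof (Rabs_mult_le (Rle_refl (Rabs m)) (bw_surface W Hzy)) as A2.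
      apply Rabs_le_between in A1, A2. pose proof (Hle z).
      assert (0 <= / 2 * (r - eta z) ^ 2 - / 2 * (r - h) ^ 2) by nra.
      unfold m in A2 |- *. lra. }
  pose proof (bw_depth W x) as Hd. pose proof (Hle x) as Hxh. pose proof (bw_eta_pos W x) as Hx0.
  apply Rle_trans with
    ((c + / 2 * (r - eta x) ^ 2 - m) + (3 * B ^ 2 + Rabs m * B) * t ^ 2).
  2: { apply Rplus_le_compat_r. unfold m. nra. }
  (* The interval has length [/ B <= 1], as required by the error bound for squared traces. *)
  apply (@derive_at_touching_end (fun y => G x y - m * p x y)
    (fun y => / 2 * (py x y ^ 2 - px x y ^ 2) - m * py x y)
    (eta x - / B) (eta x) _ _ (B ^ 2 + Rabs m * B)).
  - intros y Hy. assert (Hxy : below eta x y) by (split; lra).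
    apply (is_derive_minus (fun s => G x s) (fun s => m * p x s)); [exact (HGy x y Hxy)|].
    apply is_derive_scal, (bw_py W Hxy).
  - intros y Hy. apply Hpos. split; lra.
  - intros y Hy. assert (Hxy : below eta x y) by (split; lra).
    pose proof (HGt x y Hxy) as A1.
    pose proof (Rabs_mult_le (Rle_refl (Rabs m)) (bw_surface W Hxy)) as A2.
    apply Rabs_le_between in A1, A2. apply Rabs_le. lra.
  - intros y Hy. assert (Hxy : below eta x y) by (split; lra).
    assert (A1 := square_trace_error (t := eta x - y) ltac:(lra) HB (bw_px_le W Hxy) (Hu y Hxy)).
    assert (A2 := square_trace_error (t := eta x - y) ltac:(lra) HB (bw_py_le W Hxy) (Hv y Hxy)).
    pose proof (Rabs_mult_le (Rle_refl (Rabs m)) (Hv y Hxy)) as A3.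
    apply Rabs_le_between in A1, A2, A3. apply Rabs_le. lra.
  - lra.
Qed.

(** Here [v^2] is close to [sg^2], and [s0 <= v] both selects the positive root and gives the rate
    [|v - sg| <= C e], from [(v - sg) (v + sg) = v^2 - sg^2]. As [e] tends to 0 the hypotheses
    become [sg^2 / 2 <= m sg] and [h sg <= 1]. *)
Lemma crest_limit (sg s0 m h : R) :
  0 <= sg -> 0 < s0 -> 0 <= h ->
  (forall e, 0 < e < 1 -> exists u v, s0 <= v /\ u ^ 2 <= e * v ^ 2 /\
     sg ^ 2 <= u ^ 2 + v ^ 2 <= sg ^ 2 + e /\
     / 2 * (v ^ 2 - u ^ 2) - m * v <= e /\ h * v - 1 <= e) ->
  0 < sg /\ sg / 2 <= m /\ h * sg <= 1.
Proof.
  intros Hsg Hs0 Hh H.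
  set (C := (sg ^ 2 + 2) / s0).
  assert (Hcl : forall e, 0 < e < 1 -> exists u v, s0 <= v /\ u ^ 2 <= e * (sg ^ 2 + 1) /\
     sg ^ 2 <= u ^ 2 + v ^ 2 <= sg ^ 2 + e /\ Rabs (v - sg) <= C * e /\
     / 2 * (v ^ 2 - u ^ 2) - m * v <= e /\ h * v - 1 <= e).
  { intros e He. destruct (H e He) as [u [v [H1 [H2 [H3 [H4 H5]]]]]].
    exists u, v.
    assert (Hv2 : v ^ 2 <= sg ^ 2 + 1) by (pose proof (pow2_ge_0 u); lra).
    assert (Hu2 : u ^ 2 <= e * (sg ^ 2 + 1)) by nra.
    repeat split; try tauto.
    assert (Hd : Rabs (v - sg) * s0 <= (sg ^ 2 + 2) * e).
    { apply Rle_trans with (Rabs (v - sg) * (v + sg)).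
      - apply Rmult_le_compat_l; [apply Rabs_pos|lra].
      - rewrite <- (Rabs_right (v + sg)) by lra. rewrite <- Rabs_mult.
        apply Rabs_le. pose proof (pow2_ge_0 u). pose proof (pow2_ge_0 sg).
        split; nra. }
    apply (Rmult_le_reg_r s0); [exact Hs0|]. unfold C.
    replace ((sg ^ 2 + 2) / s0 * e * s0) with ((sg ^ 2 + 2) * e) by (field; lra). exact Hd. }
  assert (Hpos : s0 <= sg).
  { apply (@le_of_forall_small _ _ C 1); [lra|]. intros e He.
    destruct (Hcl e He) as [u [v [H1 [_ [_ [H2 _]]]]]]. apply Rabs_le_between in H2. lra. }
  split; [lra|]. split.
  - apply (Rmult_le_reg_r sg); [lra|].
    apply (@le_of_forall_small _ _ (sg ^ 2 + 2 + Rabs m * C) 1); [lra|]. intros e He.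
    destruct (Hcl e He) as [u [v [H1 [H2 [H3 [H4 [H5 _]]]]]]].
    pose proof (Rabs_mult_le (Rle_refl (Rabs m)) H4) as A. apply Rabs_le_between in A.
    nra.
  - apply (@le_of_forall_small _ _ (1 + h * C) 1); [lra|]. intros e He.
    destruct (Hcl e He) as [u [v [_ [_ [_ [H4 [_ H5]]]]]]].
    apply Rabs_le_between in H4. nra.
Qed.

(** The speed bounds give [(h2 - h1) s1 s2 <= s1 - s2], while [h2 - h1 = (s1^2 - s2^2) / 2]. If
    [s1 > s2], division by [s1 - s2] yields [(s1 + s2) s1 s2 / 2 <= 1], impossible for speeds above
    1. *)
Lemma depths_equal (h1 h2 s1 s2 r : R) :
  h1 <= h2 -> 0 <= s1 -> 0 <= s2 -> 4 <= s2 ^ 3 -> 1 <= h1 * s1 -> h2 * s2 <= 1 ->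
  s1 ^ 2 = 2 * (r - h1) -> s2 ^ 2 = 2 * (r - h2) -> h1 = h2.
Proof.
  intros Hh H1 H2 H4 A1 A2 E1 E2.
  assert (Hs2 : 1 < s2) by (apply Rnot_le_lt; intro; assert (s2 ^ 2 <= 1) by nra; nra).
  assert (Hs : s2 <= s1) by (apply Rnot_lt_le; intro; nra).
  destruct (Rle_lt_or_eq_dec _ _ Hs) as [Hlt|Heq]; [exfalso|subst; lra].
  assert (B1 : (h2 - h1) * (s2 * s1) <= s1 - s2) by nra.
  assert (B2 : h2 - h1 = (s1 - s2) * (s1 + s2) / 2) by lra.
  rewrite B2 in B1.
  assert (B3 : 1 < (s1 + s2) / 2 * (s2 * s1)) by nra.
  nra.
Qed.

Lemma bounded_wave_flow_force (B r : R) eta eta1 eta2 p px py pxx pxy pyy :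
  bounded_wave B r eta eta1 eta2 p px py pxx pxy pyy ->
  exists S : R,
    (forall x, is_RInt (fun y => / 2 * (py x y ^ 2 - px x y ^ 2) - y + r) 0 (eta x) S) /\
    (S > / 2 * r ^ 2 \/
     exists d, 0 < d /\ (forall x, eta x = d) /\
       forall x y, 0 < y < d -> p x y = y / d).
Proof.
  intros W. pose proof (bw_one W) as HB.
  assert (HB' : 0 < / B) by (apply Rinv_0_lt_compat; lra).
  destruct (bw_flow_force_potential W) as [G [c [HGx [HGy [HGb HGt]]]]].
  exists (c + / 2 * r ^ 2). split; [apply (bw_flow_force_integral W HGy HGb HGt)|].
  destruct (completeness (fun z => exists x, z = eta x)) as [h [Hh1 Hh2]].
  { exists B. intros z [x ->]. apply (bw_eta_le W). }
  { exists (eta 0), 0. reflexivity. }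
  destruct (completeness (fun z => exists x, z = - eta x)) as [l' [Hl1 Hl2]].
  { exists 0. intros z [x ->]. pose proof (bw_eta_pos W x). lra. }
  { exists (- eta 0), 0. reflexivity. }
  set (l := - l').
  assert (Hh : forall x, eta x <= h) by (intros x; apply Hh1; exists x; reflexivity).
  assert (Hl : forall x, l <= eta x).
  { intros x. assert (- eta x <= l') by (apply Hl1; exists x; reflexivity). unfold l. lra. }
  assert (Hhap : forall e, 0 < e -> exists x, h - eta x <= e).
  { intros e He. apply NNPP; intro Hno.
    assert (h <= h - e); [|lra]. apply Hh2. intros z [x ->]. apply Rnot_lt_le; intro.
    apply Hno. exists x. lra. }
  assert (Hlap : forall e, 0 < e -> exists x, eta x - l <= e).
  { intros e He. apply NNPP; intro Hno.
    assert (l' <= l' - e); [|lra]. apply Hl2. intros z [x ->]. apply Rnot_lt_le; intro.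
    apply Hno. exists x. unfold l. lra. }
  assert (Hl0 : / B <= l).
  { assert (l' <= - / B); [|unfold l; lra]. apply Hl2. intros z [x ->].
    pose proof (bw_depth W x). lra. }
  assert (Hlh : l <= h) by (pose proof (Hl 0); pose proof (Hh 0); lra).
  assert (Hhr : h <= r).
  { apply Hh2. intros z [x ->]. destruct (bw_surface_velocity W x) as [u [v [_ [_ [E _]]]]].
    pose proof (pow2_ge_0 u). pose proof (pow2_ge_0 v). lra. }
  set (sg := sqrt (2 * (r - h))). set (sg' := sqrt (2 * (r - l))).
  assert (Esg : sg ^ 2 = 2 * (r - h)) by (apply pow2_sqrt; lra).
  assert (Esg' : sg' ^ 2 = 2 * (r - l)) by (apply pow2_sqrt; lra).
  assert (Hsg : 0 <= sg) by apply sqrt_pos. assert (Hsg' : 0 <= sg') by apply sqrt_pos.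
  set (m := c + / 2 * (r - h) ^ 2).
  assert (Htrough : 1 <= l * sg').
  { apply (@le_of_forall_small _ _ 1 1); [lra|]. intros e He.
    destruct (@touching_slope_small (/ B) (Rabs (- l) * B) e HB') as [d [Hd Htou]];
      [pose proof (Rabs_pos (- l)); nra|lra|].
    destruct (Hlap d Hd) as [x Hx].
    destruct (bw_surface_velocity W x) as [u [v [_ [Hv [E _]]]]].
    assert (A : - l * v + 1 <= e).
    { apply (Htou _ (0 + - l + 1 * eta x)); [lra|]. intros t Ht.
      apply (@bw_affine_touching _ _ _ _ _ _ _ _ _ _ _ 0 (- l) 1 W x v); auto.
      intros y Hy. apply (bw_p_le_of_depth_ge W); auto. lra. }
    (* An upper bound on [v] suffices at a trough, so its sign need not be known beforehand. *)
    assert (Hvs : v <= sg').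
    { apply Rnot_lt_le; intro. pose proof (Hl x). pose proof (pow2_ge_0 u). nra. }
    nra. }
  assert (Hcrest : 0 < sg /\ sg / 2 <= m /\ h * sg <= 1).
  { destruct (bw_crest_speed_pos W Hh) as [s0 [d0 [Hs0 [Hd0 Hspeed]]]].
    apply (@crest_limit sg s0 m h Hsg Hs0); [lra|]. intros e He.
    assert (HL1 : 0 <= 3 * B ^ 2 + Rabs m * B) by (pose proof (Rabs_pos m); nra).
    assert (HL2 : 0 <= Rabs h * B) by (pose proof (Rabs_pos h); nra).
    destruct (@touching_slope_small (/ B) _ e HB' HL1) as [d1 [Hd1 T1]]; [lra|].
    destruct (@touching_slope_small (/ B) _ e HB' HL2) as [d2 [Hd2 T2]]; [lra|].
    destruct (@touching_slope_small (/ B) B e HB') as [d3 [Hd3 T3]]; [lra|lra|].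
    assert (Hr0 : 0 < r) by lra.
    (* [d1 / r] because the defect of [G - m p] is [r (h - eta x)]; [e / 2] because Bernoulli's law
       doubles the depth defect in [u ^ 2 + v ^ 2]. *)
    set (d := Rmin (Rmin d0 (d1 / r)) (Rmin (Rmin d2 d3) (e / 2))).
    assert (Hd1r : 0 < d1 / r) by (apply Rdiv_lt_0_compat; lra).
    assert (Hd : 0 < d) by (repeat apply Rmin_glb_lt; lra).
    assert (D : d <= d0 /\ d <= d1 / r /\ d <= d2 /\ d <= d3 /\ d <= e / 2).
    { unfold d. set (a1 := Rmin d0 (d1 / r)). set (a2 := Rmin (Rmin d2 d3) (e / 2)).
      pose proof (Rmin_l a1 a2). pose proof (Rmin_r a1 a2).
      pose proof (Rmin_l d0 (d1 / r) : a1 <= d0). pose proof (Rmin_r d0 (d1 / r) : a1 <= d1 / r).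
      pose proof (Rmin_l (Rmin d2 d3) (e / 2) : a2 <= Rmin d2 d3).
      pose proof (Rmin_r (Rmin d2 d3) (e / 2) : a2 <= e / 2).
      pose proof (Rmin_l d2 d3). pose proof (Rmin_r d2 d3). lra. }
    destruct D as [D0 [D1 [D2 [D3 D4]]]].
    destruct (Hhap d Hd) as [x Hx].
    destruct (bw_surface_velocity W x) as [u [v [Hu [Hv [E Eu]]]]].
    exists u, v. pose proof (Hh x) as Hxh.
    assert (Q1 : Rabs (eta1 x) <= e).
    { apply (T3 _ (h - eta x)); [lra|]. intros t Ht. apply (bw_slope_at_crest W Hh). lra. }
    split; [apply (Hspeed x v Hv); lra|]. split; [|split; [lra|split]].
    - rewrite Eu. rewrite Rpow_mult_distr. apply Rmult_le_compat_r; [apply pow2_ge_0|].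
      replace ((- eta1 x) ^ 2) with (eta1 x ^ 2) by ring. rewrite <- pow2_abs.
      pose proof (Rabs_pos (eta1 x)). nra.
    - apply (T1 _ (r * (h - eta x))).
      + replace d1 with (r * (d1 / r)) by (field; lra). apply Rmult_le_compat_l; lra.
      + intros t Ht. apply (bw_flow_force_touching W HGx HGy HGb HGt Hh Hhr Hu Hv Ht).
    - enough (h * v + -1 <= e) by lra. apply (T2 _ (0 + h + -1 * eta x)); [lra|].
      intros t Ht. apply (@bw_affine_touching _ _ _ _ _ _ _ _ _ _ _ 0 h (-1) W x v); auto.
      intros y Hy. apply (bw_p_ge_of_depth_le W); auto. lra. }
  destruct Hcrest as [Hsg0 [Hm Hhsg]].
  destruct (Rlt_le_dec (sg ^ 3) 4) as [H4|H4].
  - left. assert (Em : m = c + sg ^ 4 / 8).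
    { unfold m. replace (sg ^ 4) with ((sg ^ 2) ^ 2) by ring. rewrite Esg. field. }
    assert (0 < c); [|lra]. assert (0 < sg * (4 - sg ^ 3)) by (apply Rmult_lt_0_compat; lra).
    lra.
  - right. assert (Elh : l = h) by (apply (@depths_equal l h sg' sg r); auto).
    exists h. split; [lra|]. split.
    { intros x. pose proof (Hl x). pose proof (Hh x). lra. }
    intros x y Hy. assert (Hxy : below eta x y).
    { split; [lra|]. pose proof (Hl x). lra. }
    pose proof (bw_p_le_of_depth_ge W (h := l) ltac:(lra) Hl Hxy) as A1.
    pose proof (bw_p_ge_of_depth_le W (h := h) ltac:(lra) Hh Hxy) as A2.
    rewrite Elh in A1. apply (Rmult_eq_reg_l h); [|lra]. field_simplify; lra.
Qed.

(** * From the Hölder classes to interior estimates *)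

Lemma within_vertical (A : R * R -> Prop) (f : R * R -> R) (x y0 l : R) :
  filterlim f (within A (locally (x, y0))) (locally l) ->
  forall e, 0 < e -> exists d, 0 < d /\
    forall y, A (x, y) -> Rabs (y - y0) < d -> Rabs (f (x, y) - l) < e.
Proof.
  intros Hf e He.
  destruct (proj1 (filterlim_locally _ _) Hf (mkposreal e He)) as [d Hd].
  exists d. split; [apply cond_pos|]. intros y HA Hy.
  apply (Hd (x, y)); [|exact HA]. split; [apply ball_center|exact Hy].
Qed.

(** Upgrades a bare limit to a linear rate: [f y] is compared with [f z] for [z] near [y0] on the
    segment from [y0] to [y], which stays in the interval even when [y0] is an end point. *)
Lemma lipschitz_to_limit (f : R -> R) (a b y0 l B : R) :
  a <= y0 <= b ->
  (forall s t, a < s < b -> a < t < b -> Rabs (f s - f t) <= B * Rabs (s - t)) ->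
  (forall e, 0 < e -> exists d, 0 < d /\
     forall y, a < y < b -> Rabs (y - y0) < d -> Rabs (f y - l) < e) ->
  forall y, a < y < b -> Rabs (f y - l) <= Rabs B * Rabs (y - y0).
Proof.
  intros Hy0 HL Hlim y Hy. apply le_epsilon. intros e He.
  destruct (Hlim e He) as [d [Hd Hd']].
  pose proof (Rabs_pos (y - y0)) as Hp.
  set (th := Rmin (/ 2) (d / (2 * (Rabs (y - y0) + 1)))).
  assert (T0 : 0 < th) by (apply Rmin_glb_lt; [lra|apply Rdiv_lt_0_compat; lra]).
  assert (T1 : th <= / 2) by apply Rmin_l.
  assert (T2 : th * (Rabs (y - y0) + 1) <= d / 2).
  { replace (d / 2) with (d / (2 * (Rabs (y - y0) + 1)) * (Rabs (y - y0) + 1)) by (field; lra).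
    apply Rmult_le_compat_r; [lra|apply Rmin_r]. }
  set (z := y0 + th * (y - y0)).
  assert (Hz : a < z < b) by (unfold z; split; nra).
  assert (A1 : Rabs (z - y0) < d).
  { replace (z - y0) with (th * (y - y0)) by (unfold z; ring).
    rewrite Rabs_mult, (Rabs_right th); nra. }
  assert (A2 := HL y z Hy Hz). specialize (Hd' z Hz A1).
  replace (y - z) with ((1 - th) * (y - y0)) in A2 by (unfold z; ring).
  rewrite Rabs_mult, (Rabs_right (1 - th)) in A2 by lra.
  replace (f y - l) with ((f y - f z) + (f z - l)) by ring.
  eapply Rle_trans; [apply Rabs_triang|]. apply Rplus_le_compat; [|lra].
  eapply Rle_trans; [exact A2|].
  pose proof (Rle_abs B). pose proof (Rabs_pos B).
  apply Rle_trans with (Rabs B * ((1 - th) * Rabs (y - y0))).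
  - apply Rmult_le_compat_r; nra.
  - apply Rmult_le_compat_l; nra.
Qed.

(** At a point of the fluid the limit is taken over neighbourhoods that contain the point itself, so
    it equals the value of [f] there. *)
Lemma continuity_of_traces (eta : R -> R) (f : R * R -> R) :
  (forall x, continuous eta x) ->
  (forall q, closure (fluid_domain eta) q -> exists l, has_trace (fluid_domain eta) f q l) ->
  forall x y, below eta x y -> continuity_2d_pt (fun u v => f (u, v)) x y.
Proof.
  intros Hc Hf x y Hxy.
  destruct (Hf (x, y)) as [l Hl].
  { intros P HP. exists (x, y). split; [exact (locally_singleton _ _ HP)|exact Hxy]. }
  assert (Hle : forall e : posreal, locally_2d (fun u v => Rabs (f (u, v) - l) < e) x y).
  { intros e.
    assert (A : locally (x, y) (fun q => fluid_domain eta q -> Rabs (f q - l) < e))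
      by exact (proj1 (filterlim_locally _ _) Hl e).
    apply (locally_2d_impl (below eta)); [|apply below_open; auto].
    apply locally_2d_locally. revert A. apply filter_imp. intros [u v] HA Huv.
    apply HA, Huv. }
  assert (E : f (x, y) = l).
  { apply cond_eq. intros e He.
    exact (locally_2d_singleton _ _ _ (Hle (mkposreal e He))). }
  intros e. rewrite E. apply Hle.
Qed.

Lemma closure_vertical (eta : R -> R) (x y : R) :
  0 < eta x -> 0 <= y <= eta x -> closure (fluid_domain eta) (x, y).
Proof.
  intros Hx Hy P [d Hd].
  assert (Hd0 := cond_pos d).
  set (th := Rmin (/ 2) (d / (2 * (Rabs (eta x / 2 - y) + 1)))).
  pose proof (Rabs_pos (eta x / 2 - y)) as Hp.
  assert (T0 : 0 < th) by (apply Rmin_glb_lt; [lra|apply Rdiv_lt_0_compat; lra]).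
  assert (T1 : th <= / 2) by apply Rmin_l.
  assert (T2 : th * (Rabs (eta x / 2 - y) + 1) <= d / 2).
  { replace (d / 2) with (d / (2 * (Rabs (eta x / 2 - y) + 1)) * (Rabs (eta x / 2 - y) + 1))
      by (field; lra).
    apply Rmult_le_compat_r; [lra|apply Rmin_r]. }
  exists (x, y + th * (eta x / 2 - y)). split.
  - apply Hd. split; [apply ball_center|].
    change (Rabs (y + th * (eta x / 2 - y) - y) < d).
    replace (y + th * (eta x / 2 - y) - y) with (th * (eta x / 2 - y)) by ring.
    rewrite Rabs_mult, (Rabs_right th); nra.
  - split; simpl; nra.
Qed.

Lemma Ck_holder_upto_S (k : nat) (gamma : R) (D : R * R -> Prop) (f : R * R -> R) :
  Ck_holder_upto (S k) gamma D f ->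
  bounded_on D f /\
  (forall q, closure D q -> exists l, has_trace D f q l) /\
  (forall x y, D (x, y) -> is_derive (fun s => f (s, y)) x (d_x f (x, y))) /\
  (forall x y, D (x, y) -> is_derive (fun t => f (x, t)) y (d_y f (x, y))) /\
  Ck_holder_upto k gamma D (d_x f) /\ Ck_holder_upto k gamma D (d_y f).
Proof.
  intros [H1 [H2 [H3 [H4 H5]]]].
  split; [exact H1|split; [exact H2|split; [|split; [|split; [exact H4|exact H5]]]]];
    intros x y Hxy; apply Derive_correct; apply (H3 (x, y) Hxy).
Qed.

Lemma mixed_derivatives (eta : R -> R) (f : R * R -> R) :
  (forall x, continuous eta x) ->
  (forall x y, below eta x y -> is_derive (fun s => f (s, y)) x (d_x f (x, y))) ->
  (forall x y, below eta x y -> is_derive (fun t => f (x, t)) y (d_y f (x, y))) ->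
  (forall x y, below eta x y -> is_derive (fun t => d_x f (x, t)) y (d_y (d_x f) (x, y))) ->
  (forall x y, below eta x y -> is_derive (fun s => d_y f (s, y)) x (d_x (d_y f) (x, y))) ->
  (forall x y, below eta x y -> continuity_2d_pt (fun u v => d_y (d_x f) (u, v)) x y) ->
  (forall x y, below eta x y -> continuity_2d_pt (fun u v => d_x (d_y f) (u, v)) x y) ->
  forall x y, below eta x y -> d_x (d_y f) (x, y) = d_y (d_x f) (x, y).
Proof.
  intros Hc Hx Hy Hxy Hyx Cxy Cyx x y Hb.
  apply (Schwarz (fun u v => f (u, v)) x y).
  - destruct (below_open _ _ _ (Hc x) Hb) as [d Hd]. exists d. intros u v Hu Hv.
    specialize (Hd u v Hu Hv). repeat split.
    + eexists; apply (Hx u v Hd).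
    + eexists; apply (Hy u v Hd).
    + eexists; apply (Hyx u v Hd).
    + eexists; apply (Hxy u v Hd).
  - apply (Cyx x y Hb).
  - apply (Cxy x y Hb).
Qed.

Lemma bounded_wave_of_solution (gamma r : R) (eta : R -> R) (psi : R * R -> R) :
  C2_holder_line gamma eta -> (forall x, 0 < eta x) ->
  C2_holder_closure gamma (fluid_domain eta) psi -> steady_water_wave r psi eta ->
  exists B, bounded_wave B r eta (Derive_n eta 1) (Derive_n eta 2)
    (fun x y => psi (x, y)) (fun x y => d_x psi (x, y)) (fun x y => d_y psi (x, y))
    (fun x y => d_x (d_x psi) (x, y)) (fun x y => d_y (d_x psi) (x, y))
    (fun x y => d_y (d_y psi) (x, y)).
Proof.
  intros [Heta _] Hpos [HC2 Hcl] [Hlap Hber Hsurf Hbot].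
  destruct (Heta 0%nat ltac:(lia)) as [_ [M0 HM0]].
  destruct (Heta 1%nat ltac:(lia)) as [He1 [M1 HM1]].
  destruct (Heta 2%nat ltac:(lia)) as [He2 [M2 HM2]].
  assert (Hc : forall x, continuous eta x)
    by (intros x; apply (ex_derive_continuous eta), (He1 x)).
  apply Ck_holder_upto_S in HC2. destruct HC2 as [_ [_ [dx [dy [Hx Hy]]]]].
  apply Ck_holder_upto_S in Hx. destruct Hx as [[M3 HM3] [_ [dxx [dxy [Hxx Hxy]]]]].
  apply Ck_holder_upto_S in Hy. destruct Hy as [[M4 HM4] [_ [dyx [dyy [Hyx Hyy]]]]].
  destruct Hxx as [[M5 HM5] [Txx _]]. destruct Hxy as [[M6 HM6] [Txy _]].
  destruct Hyx as [_ [Tyx _]]. destruct Hyy as [[M7 HM7] _].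
  assert (Cxx := continuity_of_traces Hc Txx). assert (Cxy := continuity_of_traces Hc Txy).
  assert (Cyx := continuity_of_traces Hc Tyx).
  assert (Hmix := mixed_derivatives Hc dx dy dxy dyx Cxy Cyx).
  set (B := 1 + Rabs M0 + Rabs M1 + Rabs M2 + Rabs M3 + Rabs M4 + Rabs M5 + Rabs M6 + Rabs M7).
  assert (HB : 1 <= B /\ M0 <= B /\ M1 <= B /\ M2 <= B /\ M3 <= B /\ M4 <= B /\ M5 <= B /\
               M6 <= B /\ M7 <= B).
  { unfold B. pose proof (Rle_abs M0). pose proof (Rle_abs M1). pose proof (Rle_abs M2).
    pose proof (Rle_abs M3). pose proof (Rle_abs M4). pose proof (Rle_abs M5).
    pose proof (Rle_abs M6). pose proof (Rle_abs M7).
    pose proof (Rabs_pos M0). pose proof (Rabs_pos M1). pose proof (Rabs_pos M2).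
    pose proof (Rabs_pos M3). pose proof (Rabs_pos M4). pose proof (Rabs_pos M5).
    pose proof (Rabs_pos M6). pose proof (Rabs_pos M7). lra. }
  destruct HB as [B1 [B2 [B3 [B4 [B5 [B6 [B7 [B8 B9]]]]]]]].
  assert (HBa : Rabs B = B) by (apply Rabs_right; lra).
  assert (L3 : forall x y, below eta x y -> Rabs (d_x psi (x, y)) <= B)
    by (intros x y H; pose proof (HM3 (x, y) H); lra).
  assert (L4 : forall x y, below eta x y -> Rabs (d_y psi (x, y)) <= B)
    by (intros x y H; pose proof (HM4 (x, y) H); lra).
  assert (L6 : forall x y, below eta x y -> Rabs (d_y (d_x psi) (x, y)) <= B)
    by (intros x y H; pose proof (HM6 (x, y) H); lra).
  assert (L7 : forall x y, below eta x y -> Rabs (d_y (d_y psi) (x, y)) <= B)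
    by (intros x y H; pose proof (HM7 (x, y) H); lra).
  (* The set [A] is the closed domain for [psi], which is continuous up to the boundary, and the
     open domain for the traces of its gradient. *)
  assert (Hvert : forall (f : R * R -> R) (df : R * R -> R) (A : R * R -> Prop) (x y0 l : R),
    0 <= y0 <= eta x ->
    (forall y, below eta x y -> A (x, y)) ->
    filterlim f (within A (locally (x, y0))) (locally l) ->
    (forall x y, below eta x y -> is_derive (fun t => f (x, t)) y (df (x, y))) ->
    (forall x y, below eta x y -> Rabs (df (x, y)) <= B) ->
    forall y, below eta x y -> Rabs (f (x, y) - l) <= B * Rabs (y - y0)).
  { intros f df A x y0 l Hy0 HA Hf Hdf Hbd y Hb. rewrite <- HBa.
    apply (@lipschitz_to_limit (fun t => f (x, t)) 0 (eta x)); [exact Hy0| | |exact Hb].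
    - apply (@derive_bound_lipschitz _ (fun t => df (x, t))); intros t Ht; auto.
    - intros e He. destruct (within_vertical Hf He) as [d [Hd Hd']].
      exists d. split; [exact Hd|]. intros t Ht. apply Hd', HA, Ht. }
  assert (Hclo : forall x y, below eta x y -> closure (fluid_domain eta) (x, y)).
  { intros x y [H1 H2]. apply closure_vertical; [apply Hpos|lra]. }
  exists B. constructor.
  - exact B1.
  - exact Hpos.
  - intros x. pose proof (HM0 x I) as A. simpl in A. pose proof (Rle_abs (eta x)). lra.
  - intros x. pose proof (HM1 x I). lra.
  - intros x. pose proof (HM2 x I). lra.
  - intros x. apply (Derive_correct eta), (He1 x).
  - intros x. apply (Derive_correct (Derive_n eta 1)), (He2 x).
  - exact dx.
  - exact dy.
  - exact dxx.
  - exact dxy.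
  - intros x y Hb. rewrite <- Hmix by exact Hb. apply dyx, Hb.
  - exact dyy.
  - exact Cxx.
  - exact Cxy.
  - exact L3.
  - exact L4.
  - intros x y Hb. pose proof (HM5 (x, y) Hb). lra.
  - exact L6.
  - exact L7.
  - intros x y Hb. apply (Hlap (x, y)), Hb.
  - intros x y Hb. pose proof (Hpos x).
    assert (Hx0 : closure (fluid_domain eta) (x, 0)) by (apply closure_vertical; lra).
    assert (A := Hvert psi (d_y psi) (closure (fluid_domain eta)) x 0 (psi (x, 0))
                   ltac:(lra) (Hclo x) (Hcl _ Hx0) dy L4 y Hb).
    rewrite Hbot, !Rminus_0_r, (Rabs_right y) in A by (destruct Hb; lra). exact A.
  - intros x y Hb. pose proof (Hpos x).
    assert (Hx0 : closure (fluid_domain eta) (x, eta x)) by (apply closure_vertical; lra).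
    assert (A := Hvert psi (d_y psi) (closure (fluid_domain eta)) x (eta x) (psi (x, eta x))
                   ltac:(lra) (Hclo x) (Hcl _ Hx0) dy L4 y Hb).
    rewrite Hsurf, (Rabs_minus_sym y), (Rabs_right (eta x - y)) in A by (destruct Hb; lra).
    exact A.
  - intros x. pose proof (Hpos x). destruct (Hber x) as [u [v [Hu [Hv E]]]].
    exists u, v. split; [|split; [|exact E]]; intros y Hb.
    + assert (A := Hvert (d_x psi) (d_y (d_x psi)) (fluid_domain eta) x (eta x) u
                     ltac:(lra) (fun y Hy => Hy) Hu dxy L6 y Hb).
      rewrite (Rabs_minus_sym y), (Rabs_right (eta x - y)) in A by (destruct Hb; lra).
      exact A.
    + assert (A := Hvert (d_y psi) (d_y (d_y psi)) (fluid_domain eta) x (eta x) v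
                     ltac:(lra) (fun y Hy => Hy) Hv dyy L7 y Hb).
      rewrite (Rabs_minus_sym y), (Rabs_right (eta x - y)) in A by (destruct Hb; lra).
      exact A.
Qed.

Unset Implicit Arguments.
Set Strict Implicit.

Theorem theorem2p1 (gamma : R) (hgamma : 0 < gamma < 1) (r : R)
    (eta : R -> R) (heta : C2_holder_line gamma eta) (heta_pos : forall x : R, 0 < eta x)
    (psi : R * R -> R) (hpsi : C2_holder_closure gamma (fluid_domain eta) psi)
    (hsol : steady_water_wave r psi eta)
    (hnl : ~ laminar_flow psi eta) :
  exists S : R, flow_force_constant r psi eta S /\ S > / 2 * r ^ 2.
Proof.
  destruct (bounded_wave_of_solution heta heta_pos hpsi hsol) as [B W].
  destruct (bounded_wave_flow_force W) as [S [HS Halt]].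
  exists S. split; [exact HS|].
  destruct Halt as [H|[d [Hd [Heta Hpsi]]]]; [exact H|exfalso; apply hnl].
  exists d. split; [exact Hd|split; [exact Heta|]]. intros x y [H0 H1].
  (* The linear profile is known for [0 < y < d]; at the two end points it comes from the boundary
     conditions. *)
  destruct (Rle_lt_or_eq_dec _ _ H0) as [H0'|<-].
  - destruct (Rle_lt_or_eq_dec _ _ H1) as [H1'| ->].
    + apply Hpsi; lra.
    + rewrite <- (Heta x) at 1. rewrite (surface_eq _ _ _ hsol). field. lra.
  - rewrite (bottom_eq _ _ _ hsol). field. lra.
Qed.
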